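(* Fix $1\le p_0<q<q_0\le\infty$ and let $\mathbb B=(B_Q)_{Q\in\mathcal Q}$ satisfy conditions (b) and (c) below (commutativity is not assumed). Assume further that for all cubes $R\subset Q$ and all $f$, $$A_RA_Qf(x)=A_Qf(x)\quad\text{for a.e. }x\in2R.$$ Let $f\in L^{p_0}_{loc}(\mathbb R^n)$ and let $a$ be a functional such that $(\fint_{2^kQ}|B_Qf|^{p_0})^{1/p_0}\le a(2^kQ)$ for every integer $k\ge0$ and every cube $Q$. If $a\in D_q$, then for every cube $Q$, $$\|B_Qf\|_{L^{q,\infty},Q}\le C\sum_{k\ge1}\eta_k\,a(2^kQ),$$ where $\eta_1=1$, $\eta_k=\alpha_k2^{kn/p_0}$ for $k\ge2$, and $C$ is independent of $Q$ and $f$.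
   Context: Cubes $Q=\prod_i[a_i,a_i+\ell(Q))$; $\lambda Q$ is the concentric cube of sidelength $\lambda\ell(Q)$; $\mathcal Q$ is the set of all cubes; $\fint_Eg=|E|^{-1}\int_Eg$; $\|g\|_{L^{q,\infty},Q}=\sup_{t>0}t(|\{x\in Q:|g(x)|>t\}|/|Q|)^{1/q}$. A functional is a map $a:\mathcal Q\to[0,\infty)$. $\mathbb B=(B_Q)_{Q\in\mathcal Q}$ are linear operators defined on $L^{p_0}_{loc}(\mathbb R^n)$ and $A_Q=I-B_Q$. Condition (b): there is $C_{p_0}$ with $\|B_Qf\|_{L^{p_0}(\mathbb R^n)}\le C_{p_0}\|f\|_{L^{p_0}(\mathbb R^n)}$ for all cubes $Q$. Condition (c): there are $\alpha_k\ge0$, $k\ge2$, with $\sum_k2^{kn/p_0}\alpha_k<\infty$, such that for every cube $Q$, $(\fint_{2Q}|A_Q(f\chi_{4Q})|^{q_0})^{1/q_0}\le\alpha_2(\fint_{4Q}|f|^{p_0})^{1/p_0}$ and, for all $j\ge1$, $(\fint_{2^jQ}|A_Q(f\chi_{\mathbb R^n\setminus2^{j+1}Q})|^{q_0})^{1/q_0}\le\sum_{k\ge2}\alpha_{k+j}(\fint_{2^{k+j}Q}|f|^{p_0})^{1/p_0}$ (essential suprema when $q_0=\infty$). $a\in D_q$ means there is $C\ge1$ such that $\sum_ia(Q_i)^q|Q_i|\le C^qa(Q)^q|Q|$ for every cube $Q$ and every family of pairwise disjoint cubes $Q_i\subset Q$. *)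

(* Defs.v *)
From HB Require Import structures.
From mathcomp Require Import all_boot all_order all_algebra.
From mathcomp Require Import all_classical all_reals all_analysis.
Import Order.TTheory GRing.Theory Num.Theory.
Import numFieldNormedType.Exports.
Set Implicit Arguments. Unset Strict Implicit. Unset Printing Implicit Defensive.
Local Open Scope classical_set_scope.
Local Open Scope ring_scope.

Record mspace (R : realType) := MSpace {
  ms_disp : measure_display;
  ms_car : measurableType ms_disp;
  ms_mes : {measure set ms_car -> \bar R} }.

Fixpoint Rsp (R : realType) (n : nat) : mspace R :=
  match n with
  | 0 => @MSpace R _ unit (@dirac _ unit tt R)
  | m.+1 => let S := Rsp R m in
     @MSpace R _ _ (@lebesgue_measure R \x^ ms_mes S)%E
  end.

Definition Rn (R : realType) (n : nat) : measurableType (ms_disp (Rsp R n)) :=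
  ms_car (Rsp R n).
Definition leb (R : realType) (n : nat) : {measure set Rn R n -> \bar R} :=
  ms_mes (Rsp R n).

Fixpoint coord (R : realType) (n : nat) : Rn R n -> 'I_n -> R :=
  match n return Rn R n -> 'I_n -> R with
  | 0 => fun _ _ => 0
  | m.+1 => fun x i => match unlift ord0 i with
                      | None => x.1
                      | Some j => @coord R m x.2 j end
  end.

Record cube (R : realType) (n : nat) := Cube {
  corner : 'I_n -> R;
  side : R;
  side_gt0 : 0 < side }.

Definition cset (R : realType) (n : nat) (Q : cube R n) : set (Rn R n) :=
  [set x | forall i, corner Q i <= coord x i < corner Q i + side Q].

Definition vol (R : realType) (n : nat) (Q : cube R n) : R := side Q ^+ n.

Lemma dil_side_gt0 (R : realType) (n : nat) (k : nat) (Q : cube R n) :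
  0 < 2 ^+ k * side Q.
Proof. by rewrite mulr_gt0 ?exprn_gt0 ?side_gt0. Qed.

(* dil k Q = 2^k Q, the concentric cube of sidelength 2^k l(Q) *)
Definition dil (R : realType) (n : nat) (k : nat) (Q : cube R n) : cube R n :=
  @Cube R n (fun i => corner Q i + side Q / 2 - 2 ^+ k * side Q / 2)
    (2 ^+ k * side Q) (dil_side_gt0 k Q).

Definition restr (R : realType) (n : nat) (E : set (Rn R n)) (f : Rn R n -> R)
  : Rn R n -> R := fun x => \1_E x * f x.

Local Open Scope ereal_scope.

Definition Lp (R : realType) (n : nat) (p : R) (f : Rn R n -> R) : Prop :=
  measurable_fun setT f /\ \int[leb R n]_x (`|f x| `^ p)%:E < +oo.

Definition Lploc (R : realType) (n : nat) (p : R) (f : Rn R n -> R) : Prop :=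
  measurable_fun setT f /\
  forall Q : cube R n, \int[leb R n]_(x in cset Q) (`|f x| `^ p)%:E < +oo.

Definition avgp (R : realType) (n : nat) (p : R) (Q : cube R n)
  (g : Rn R n -> R) : \bar R :=
  (((vol Q)^-1)%:E * \int[leb R n]_(x in cset Q) (`|g x| `^ p)%:E) `^ p^-1.

Definition esssup_on (R : realType) (n : nat) (Q : cube R n)
  (g : Rn R n -> R) : \bar R :=
  ereal_inf [set y : \bar R |
    {ae leb R n, forall x, cset Q x -> (`|g x|)%:E <= y}].

Definition avgq (R : realType) (n : nat) (q : \bar R) (Q : cube R n)
  (g : Rn R n -> R) : \bar R :=
  match q with
  | r%:E => avgp r Q g
  | _ => esssup_on Q g
  end.

Definition weaknorm (R : realType) (n : nat) (q : R) (Q : cube R n)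
  (g : Rn R n -> R) : \bar R :=
  ereal_sup [set t%:E * ((((vol Q)^-1)%:E *
                 leb R n (cset Q `&` [set x | t < `|g x|]%R)) `^ q^-1)
            | t in [set t : R | (0 < t)%R]].

Local Close Scope ereal_scope.

Definition Aop (R : realType) (n : nat)
  (B : cube R n -> (Rn R n -> R) -> (Rn R n -> R)) (Q : cube R n)
  (f : Rn R n -> R) : Rn R n -> R := fun x => f x - B Q f x.

(* the B_Q are linear operators defined on L^{p0}_loc (maps of a.e.-classes
   to a.e.-classes of measurable functions) *)
Definition linear_on_Lploc (R : realType) (n : nat) (p0 : R)
  (B : cube R n -> (Rn R n -> R) -> (Rn R n -> R)) : Prop :=
  forall Q : cube R n,
    (forall f, Lploc p0 f -> measurable_fun setT (B Q f)) /\
    (forall f g, Lploc p0 f -> Lploc p0 g ->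
       {ae leb R n, forall x, f x = g x} ->
       {ae leb R n, forall x, B Q f x = B Q g x}) /\
    (forall f g, Lploc p0 f -> Lploc p0 g ->
       {ae leb R n, forall x, B Q (fun y => f y + g y) x = B Q f x + B Q g x}) /\
    (forall (c : R) f, Lploc p0 f ->
       {ae leb R n, forall x, B Q (fun y => c * f y) x = c * B Q f x}).

Definition cond_b (R : realType) (n : nat) (p0 : R)
  (B : cube R n -> (Rn R n -> R) -> (Rn R n -> R)) : Prop :=
  exists Cp0 : R, forall (Q : cube R n) (f : Rn R n -> R), Lp p0 f ->
    (Lnorm (leb R n) p0%:E (EFin \o B Q f)
       <= Cp0%:E * Lnorm (leb R n) p0%:E (EFin \o f))%E.

Definition cond_c (R : realType) (n : nat) (p0 : R) (q0 : \bar R)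
  (B : cube R n -> (Rn R n -> R) -> (Rn R n -> R)) (alpha : nat -> R) : Prop :=
  (forall k, (2 <= k)%N -> 0 <= alpha k) /\
  (\sum_(2 <= k <oo) ((2 `^ (k%:R * n%:R / p0) * alpha k)%:E) < +oo)%E /\
  (forall (Q : cube R n) (f : Rn R n -> R), Lploc p0 f ->
     (avgq q0 (dil 1 Q) (Aop B Q (restr (cset (dil 2 Q)) f))
       <= (alpha 2%N)%:E * avgp p0 (dil 2 Q) f)%E) /\
  (forall (Q : cube R n) (f : Rn R n -> R) (j : nat), (1 <= j)%N -> Lploc p0 f ->
     (avgq q0 (dil j Q) (Aop B Q (restr (~` cset (dil j.+1 Q)) f))
       <= \sum_(2 <= k <oo) ((alpha (k + j)%N)%:E * avgp p0 (dil (k + j) Q) f))%E).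

Definition Dq_with (R : realType) (n : nat) (q : R) (a : cube R n -> R)
  (C : R) : Prop :=
  forall (Q : cube R n) (I : choiceType) (F : I -> cube R n),
    (forall i j, i <> j -> cset (F i) `&` cset (F j) = set0) ->
    (forall i, cset (F i) `<=` cset Q) ->
    (\esum_(i in [set: I]) ((a (F i) `^ q * vol (F i))%:E)
       <= ((C * a Q) `^ q * vol Q)%:E)%E.

Definition Dq (R : realType) (n : nat) (q : R) (a : cube R n -> R) : Prop :=
  exists2 C : R, 1 <= C & Dq_with q a C.

Definition etak (R : realType) (n : nat) (p0 : R) (alpha : nat -> R) (k : nat) : R :=
  if (k <= 1)%N then 1 else alpha k * 2 `^ (k%:R * n%:R / p0).

(* Main.v *)
Require Import Defs.
From HB Require Import structures.
From mathcomp Require Import all_boot all_order all_algebra.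
From mathcomp Require Import all_classical all_reals all_analysis.
From mathcomp Require Import measurable_realfun ring lra.
Import Order.TTheory GRing.Theory Num.Theory.
Set Implicit Arguments. Unset Strict Implicit. Unset Printing Implicit Defensive.
Local Open Scope classical_set_scope.
Local Open Scope ring_scope.

(* Fix Q and put g = B_Q f.  Let Omega(t) be the union of the maximal dyadic subcubes S
   of Q on which the average of |g|^p0 over 2S exceeds t^p0; outside Omega(t) one has
   |g| <= 2^(n/p0) t almost everywhere.  Since A_S A_Q f = A_Q f on 2S, linearity gives
   g = B_S f + A_S g there.  The first term is controlled by a(2S).  For the second,
   condition (c) bounds its L^q0 average over 2S by sum_k alpha_k (averages of g over
   2^k S); a dilate inside the k-th ancestor of S has average at most C t by maximality,
   and a larger one is compared with 2^k Q, which costs the factor 2^(kn/p0) of eta_k.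
   As q < q0 this yields the good-lambda inequality
     |Omega(K t)| <= delta |Omega(t)| + C (sum_k eta_k a(2^k Q) / t)^q |Q|,
   with K^q delta <= 1/2, where the cubes S with a(2S) > e t are counted by D_q; it is
   iterated along t = K^m t0. *)

(** * Dyadic cubes *)

HB.instance Definition _ (R : realType) (n : nat) := gen_eqMixin (cube R n).
HB.instance Definition _ (R : realType) (n : nat) := gen_choiceMixin (cube R n).

Definition subc (R : realType) (n : nat) (P Q : cube R n) : Prop :=
  (forall i, corner Q i <= corner P i /\
     corner P i + side P <= corner Q i + side Q) /\ side P <= side Q.

Definition cunion (R : realType) (n : nat) (L : seq (cube R n)) : set (Rn R n) :=
  \bigcup_(P in [set` L]) cset P.

Lemma half_side_gt0 (R : realType) (n : nat) (P : cube R n) : 0 < side P / 2.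
Proof. by rewrite divr_gt0 ?side_gt0. Qed.

Definition child (R : realType) (n : nat) (P : cube R n) (e : {ffun 'I_n -> bool})
  : cube R n :=
  @Cube R n (fun i => corner P i + (e i)%:R * (side P / 2)) (side P / 2)
    (half_side_gt0 P).

(* The maximal dyadic descendants of P, of generation at most M, satisfying c *)
Fixpoint sel (R : realType) (n : nat) (c : pred (cube R n)) (M : nat)
    (P : cube R n) : seq (cube R n) :=
  if c P then [:: P] else
  if M is M'.+1 then
    flatten [seq sel c M' (child P e) | e <- enum {ffun 'I_n -> bool}]
  else [::].

Fixpoint lev (R : realType) (n : nat) (N : nat) (P : cube R n) : seq (cube R n) :=
  if N is N'.+1 then
    flatten [seq lev N' (child P e) | e <- enum {ffun 'I_n -> bool}]
  else [:: P].

Section geometry.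
Context (R : realType) (n : nat).
Implicit Types (P Q S : cube R n) (L : seq (cube R n)) (c : pred (cube R n)).

Lemma subc_refl P : subc P P.
Proof. by split=> // i; rewrite !lexx. Qed.

Lemma subc_trans P Q S : subc P Q -> subc Q S -> subc P S.
Proof.
move=> [PQ sPQ] [QS sQS]; split; last exact: le_trans sPQ sQS.
by move=> i; have [? ?] := PQ i; have [? ?] := QS i; split; lra.
Qed.

Lemma subc_cset P Q : subc P Q -> cset P `<=` cset Q.
Proof.
move=> [PQ _] x Px i; have [? ?] := PQ i; have /andP[? ?] := Px i.
by apply/andP; split; lra.
Qed.

Lemma subc_dil k P Q : subc P Q -> subc (dil k P) (dil k Q).
Proof.
move=> [PQ sPQ]; have k1 : 1 <= 2 ^+ k :> R by rewrite exprn_ege1 // ler1n.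
have kpq : 0 <= (2 ^+ k - 1) * (side Q - side P) by rewrite mulr_ge0 ?subr_ge0.
split=> [i|] /=; last by rewrite ler_wpM2l // ltW // exprn_gt0.
by have [? ?] := PQ i; split; lra.
Qed.

Lemma subc_dil_anc k P Q : subc P Q -> side Q = 2 ^+ k * side P ->
  subc (dil k P) (dil 1 Q).
Proof.
move=> [PQ sPQ] sQ; have P0 := side_gt0 P; split=> [i|] /=.
  by rewrite -sQ expr1; have [? ?] := PQ i; split; lra.
by rewrite -sQ expr1; lra.
Qed.

Lemma dil_meet P Q : side P <= side Q -> cset (dil 1 P) `&` cset (dil 1 Q) !=set0 ->
  cset P `<=` cset (dil 3 Q).
Proof.
move=> sPQ [x [Px Qx]] y Py i; have P0 := side_gt0 P.
have /andP[] := Px i; have /andP[] := Qx i; have /andP[] := Py i => /=.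
rewrite expr1 => *.
have -> : 2 ^+ 3 = 8 :> R by rewrite !exprS expr0; lra.
by apply/andP; split; lra.
Qed.

Lemma subc_dil_self k P : subc P (dil k P).
Proof.
have P0 := side_gt0 P; have k1 : 1 <= 2 ^+ k :> R by rewrite exprn_ege1 // ler1n.
have kP : 0 <= (2 ^+ k - 1) * side P by rewrite mulr_ge0 ?subr_ge0 // ltW.
by split=> [i|] /=; [split; lra|lra].
Qed.

Lemma max_side L : L != [::] ->
  exists2 Q, Q \in L & forall P, P \in L -> side P <= side Q.
Proof.
elim: L => // P [|P' L] IH _.
  by exists P; [rewrite mem_head|move=> S; rewrite inE => /eqP ->].
have [//|Q QL Qmax] := IH; have [PQ|QP] := leP (side P) (side Q).
  exists Q; first by rewrite inE QL orbT.
  by move=> S; rewrite inE => /orP[/eqP->//|]; exact: Qmax.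
exists P; first exact: mem_head.
move=> S; rewrite inE => /orP[/eqP->//|/Qmax]; move/le_trans; apply; exact: ltW.
Qed.

Definition disj_dil P Q : bool := `[< cset (dil 1 P) `&` cset (dil 1 Q) = set0 >].

Lemma vitali_cubes L : exists L', [/\ {subset L' <= L}, pairwise disj_dil L' &
  cunion L `<=` \bigcup_(P in [set` L']) cset (dil 3 P)].
Proof.
have [k] := ubnP (size L); elim: k L => // k IH L sL.
have [->|L0] := eqVneq L [::].
  by exists [::]; split=> // x [P]; rewrite /= in_nil.
have [Q QL Qmax] := max_side L0.
pose L1 := [seq P <- L | (P != Q) && disj_dil Q P].
have sL1 : (size L1 < k)%N.
  rewrite -ltnS (leq_trans _ sL) // ltnS size_filter.
  rewrite -(count_predC (fun P => (P != Q) && disj_dil Q P) L) -addn1 leq_add2l.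
  by rewrite -has_count; apply/hasP; exists Q => //=; rewrite eqxx.
have [L2 [L21 dL2 cL2]] := IH _ sL1.
exists (Q :: L2); split.
- move=> P; rewrite inE => /orP[/eqP->//|/L21].
  by rewrite mem_filter => /andP[].
- rewrite pairwise_cons dL2 andbT; apply/allP => P /L21.
  by rewrite mem_filter => /andP[/andP[]].
- move=> x [P /= PL Px]; have [PQ|PQ] := eqVneq P Q.
    exists Q; first by rewrite /= mem_head.
    by rewrite -PQ; exact: subc_cset (subc_dil_self 3 P) _ Px.
  have [PdQ|PdQ] := boolP (disj_dil Q P).
    have [|S SL2 Sx] := cL2 x.
      by exists P => //=; rewrite mem_filter PQ PdQ.
    by exists S => //=; rewrite inE SL2 orbT.
  exists Q; first by rewrite /= mem_head.
  apply: (dil_meet (Qmax _ PL)) Px; apply/set0P; rewrite setIC.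
  by apply: contra PdQ => /eqP ?; apply/asboolP.
Qed.

Lemma side_child P e : side (child P e) = side P / 2. Proof. by []. Qed.

Lemma subc_child P e : subc (child P e) P.
Proof.
have P0 := side_gt0 P; split=> [i|] /=; last by lra.
by case: (e i) => /=; split; lra.
Qed.

Lemma child_cover P x : cset P x -> exists e, cset (child P e) x.
Proof.
move=> Px; exists [ffun i => corner P i + side P / 2 <= Defs.coord x i].
move=> i; rewrite /= ffunE; have /andP[? ?] := Px i.
by case: (leP (corner P i + side P / 2)) => /= ?; apply/andP; split; lra.
Qed.

Lemma child_disj P e e' x : cset (child P e) x -> cset (child P e') x -> e = e'.
Proof.
move=> Px Px'; apply/ffunP => i; have := Px i; have := Px' i; rewrite /=.
by case: (e i); case: (e' i) => //= /andP[? ?] /andP[? ?]; exfalso; lra.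
Qed.

Lemma selS c M P : sel c M.+1 P = if c P then [:: P] else
  flatten [seq sel c M (child P e) | e <- enum {ffun 'I_n -> bool}].
Proof. by []. Qed.

Lemma sel_children c M P S :
  S \in flatten [seq sel c M (child P e) | e <- enum {ffun 'I_n -> bool}] ->
  exists e, S \in sel c M (child P e).
Proof. by move=> /flattenP[s /mapP[e _ ->]]; exists e. Qed.

Lemma children_sel c M P e S : S \in sel c M (child P e) ->
  S \in flatten [seq sel c M (child P e) | e <- enum {ffun 'I_n -> bool}].
Proof.
by move=> h; apply/flattenP; exists (sel c M (child P e)) => //; apply/map_f; rewrite mem_enum.
Qed.

Lemma sel_crit c M P S : S \in sel c M P -> c S.
Proof.
elim: M P => [|M IH] P /=; case: ifPn => cP //.
- by rewrite inE => /eqP ->.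
- by rewrite inE => /eqP ->.
- by move=> /sel_children[e]; exact: IH.
Qed.

Lemma sel_subc c M P S : S \in sel c M P -> subc S P.
Proof.
elim: M P => [|M IH] P /=; case: ifPn => cP //.
- by rewrite inE => /eqP ->; exact: subc_refl.
- by rewrite inE => /eqP ->; exact: subc_refl.
- by move=> /sel_children[e] /IH /subc_trans; apply; exact: subc_child.
Qed.

Lemma sel_ancestor c M P S : S \in sel c M P -> exists N, side P = 2 ^+ N * side S /\
  forall k, (1 <= k <= N)%N -> exists A, [/\ side A = 2 ^+ k * side S, subc S A & ~~ c A].
Proof.
elim: M P => [|M IH] P /=; case: ifPn => cP //.
- by rewrite inE => /eqP ->; exists 0%N; rewrite expr0 mul1r; split => // -[].
- by rewrite inE => /eqP ->; exists 0%N; rewrite expr0 mul1r; split => // -[].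
move=> /sel_children[e Se]; have [N [sN AN]] := IH _ Se.
have sP : side P = 2 ^+ N.+1 * side S by rewrite exprS -mulrA -sN side_child; lra.
exists N.+1; split=> // k /andP[k1]; rewrite leq_eqVlt => /orP[/eqP ->|kN].
  by exists P; split=> //; apply: subc_trans (sel_subc Se) _; exact: subc_child.
by apply: AN; rewrite k1.
Qed.

Lemma sel_sub c c' M P S : (forall T, c' T -> c T) -> S \in sel c' M P ->
  exists2 T, T \in sel c M P & subc S T.
Proof.
move=> cc'; elim: M P => [|M IH] P /=.
  case: ifPn => // /cc' ->; rewrite inE => /eqP ->.
  by exists P; [rewrite mem_head|exact: subc_refl].
case: ifPn => [/cc' ->|_].
  by rewrite inE => /eqP ->; exists P; [rewrite mem_head|exact: subc_refl].
move=> /sel_children[e Se]; case: ifPn => [_|_].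
  exists P; first by rewrite mem_head.
  exact: subc_trans (sel_subc Se) (subc_child _ _).
by have [T Te ST] := IH _ Se; exists T => //; exact: children_sel Te.
Qed.

Lemma cunion_children (f : cube R n -> seq (cube R n)) P :
  cunion (flatten [seq f (child P e) | e <- enum {ffun 'I_n -> bool}]) =
  \bigcup_e cunion (f (child P e)).
Proof.
apply/seteqP; split=> x.
  by move=> [S /flattenP[s /mapP[e _ ->]] Se Sx]; exists e => //; exists S.
move=> [e _ [S Se Sx]]; exists S => //; apply/flattenP; exists (f (child P e)) => //.
by apply/map_f; rewrite mem_enum.
Qed.

Lemma cunion_sub L P : (forall S, S \in L -> subc S P) -> cunion L `<=` cset P.
Proof. by move=> LP x [S /LP /subc_cset]; apply. Qed.

Lemma sel_mono c M P : cunion (sel c M P) `<=` cunion (sel c M.+1 P).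
Proof.
elim: M P => [|M IH] P.
  by rewrite [sel c 0 P]/= [sel c 1 P]/=; case: ifPn => [_|_]; [exact: subset_refl|move=> x []].
rewrite (selS c M P) (selS c M.+1 P); case: ifPn => [_|_]; first exact: subset_refl.
rewrite (cunion_children (sel c M)) (cunion_children (sel c M.+1)).
by move=> x [e _ ex]; exists e => //; exact: IH.
Qed.

Lemma lev_children N P S :
  S \in lev N.+1 P -> exists e, S \in lev N (child P e).
Proof. by move=> /flattenP[s /mapP[e _ ->]]; exists e. Qed.

Lemma children_lev N P e S : S \in lev N (child P e) -> S \in lev N.+1 P.
Proof.
by move=> h; apply/flattenP; exists (lev N (child P e)) => //; apply/map_f; rewrite mem_enum.
Qed.

Lemma lev_subc N P S : S \in lev N P -> subc S P.
Proof.
elim: N P => [|N IH] P; first by rewrite /= inE => /eqP ->; exact: subc_refl.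
by move=> /lev_children[e /IH] /subc_trans; apply; exact: subc_child.
Qed.

Lemma lev_sel c N P S : S \in lev N P -> c S -> cset S `<=` cunion (sel c N P).
Proof.
elim: N P => [|N IH] P.
  by rewrite /= inE => /eqP -> ->; move=> x Px; exists P => //=; rewrite mem_head.
move=> /lev_children[e Se] cS /=; case: ifPn => _.
  move=> x Sx; exists P => //=; first by rewrite mem_head.
  exact: subc_cset (subc_trans (lev_subc Se) (subc_child P e)) _ Sx.
by rewrite (cunion_children (sel c N)) => x Sx; exists e => //; apply: IH Sx.
Qed.

Lemma lev_side N P S : S \in lev N P -> side P = 2 ^+ N * side S.
Proof.
elim: N P => [|N IH] P; first by rewrite /= inE => /eqP ->; rewrite expr0 mul1r.
by move=> /lev_children[e /IH]; rewrite side_child exprS; lra.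
Qed.

Lemma lev_cover N P x : cset P x -> exists2 S, S \in lev N P & cset S x.
Proof.
elim: N P => [|N IH] P Px; first by exists P => //=; rewrite mem_head.
have [e /IH[S Se Sx]] := child_cover Px.
by exists S => //; exact: children_lev Se.
Qed.

Lemma lev_disj N P S T x :
  S \in lev N P -> T \in lev N P -> cset S x -> cset T x -> S = T.
Proof.
elim: N P => [|N IH] P; first by rewrite /= !mem_seq1 => /eqP SP /eqP TP _ _; rewrite SP TP.
move=> /lev_children[e Se] /lev_children[e' Te] Sx Tx.
have ee' : e = e'.
  by apply: (child_disj (x := x));
    [exact: subc_cset (lev_subc Se) _ Sx|exact: subc_cset (lev_subc Te) _ Tx].
by subst e'; exact: IH Se Te Sx Tx.
Qed.

Lemma lev_refine N M P S : S \in lev (N + M) P ->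
  exists2 T, T \in lev N P & subc S T.
Proof.
elim: N P => [|N IH] P SP; first by exists P; [rewrite mem_head|exact: lev_subc SP].
have [e /IH[T Te ST]] := lev_children SP.
by exists T => //; exact: children_lev Te.
Qed.

End geometry.

(** * Lebesgue measure of cubes *)

Section measure_Rn.
Context (R : realType).

Lemma coordE (n : nat) (x : Rn R n.+1) (i : 'I_n.+1) :
  Defs.coord x i = if unlift ord0 i is Some j then Defs.coord (n := n) x.2 j else x.1.
Proof. by rewrite /=; case: unlift. Qed.

Lemma measurable_coord (n : nat) (i : 'I_n) :
  measurable_fun [set: Rn R n] (fun x => Defs.coord x i : R).
Proof.
elim: n i => [[]//|n IH] i.
rewrite (_ : (fun x : Rn R n.+1 => _) = fun x =>
  if unlift ord0 i is Some j then Defs.coord (n := n) x.2 j else x.1); last first.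
  by apply/funext => x; exact: coordE.
case: (unlift ord0 i) => [j|]; last exact: measurable_fst.
by apply: (measurableT_comp (IH j)); exact: measurable_snd.
Qed.

Lemma cset_prod (n : nat) (Q : cube R n.+1) :
  cset Q = `[corner Q ord0, corner Q ord0 + side Q[%classic `*`
           cset (@Cube R n (fun i => corner Q (lift ord0 i)) (side Q) (side_gt0 Q)).
Proof.
apply/seteqP; split => x.
  move=> Qx; split=> [|i]; last first.
    by have := Qx (lift ord0 i); rewrite coordE liftK.
  by have := Qx ord0; rewrite coordE unlift_none /= in_itv.
move=> [/= x1 x2] i; rewrite coordE.
case: (unliftP ord0 i) => [j ->|->]; last by move: x1; rewrite in_itv.
exact: x2.
Qed.

Lemma measurable_cset (n : nat) (Q : cube R n) : measurable (cset Q).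
Proof.
elim: n Q => [|n IH] Q; first by [].
rewrite cset_prod; apply: measurableX; last exact: IH.
exact: measurable_itv.
Qed.

Lemma leb_cset (n : nat) (Q : cube R n) : leb R n (cset Q) = (vol Q)%:E.
Proof.
elim: n Q => [|n IH] Q.
  rewrite /vol expr0 /leb /= diracE mem_set//.
  by case.
rewrite cset_prod /leb /=.
rewrite product_measure2E; [|exact: measurable_itv|exact: measurable_cset].
have -> := IH (@Cube R n (fun i => corner Q (lift ord0 i)) (side Q) (side_gt0 Q)).
have h : lebesgue_measure (`[corner Q ord0, corner Q ord0 + side Q[%classic : set R)
    = (side Q)%:E.
  by rewrite lebesgue_measure_itv /= lte_fin ltrDl side_gt0 -EFinB addrC addKr.
by rewrite [X in (X * _)%E]h -EFinM /vol exprS.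
Qed.

Lemma sigma_algebra_coord (T : Type) (n : nat) (K : set (set T)) (phi : T -> Rn R n) :
  sigma_algebra setT K ->
  (forall i b, K [set x | Defs.coord (phi x) i < b]) ->
  forall E : set (Rn R n), measurable E -> K (phi @^-1` E).
Proof.
move=> [K0 KC KU].
have KC' A : K A -> K (~` A) by move=> /KC; rewrite setTD.
elim: n phi => [|n IH] phi Kc E mE.
  have [Ett|Ett] := pselect (E tt).
    rewrite (_ : _ @^-1` _ = ~` set0); first exact: KC'.
    by rewrite setC0; apply/seteqP; split => x //= _; case: (phi x).
  rewrite (_ : _ @^-1` _ = set0) //.
  by apply/seteqP; split => x //=; case: (phi x).
have h1 (A : set R) : measurable A -> K ((fst \o phi) @^-1` A).
  move=> mA; have := eq_ind _ (fun X : set (set R) => X A) mA _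
    (measurable_realfun.RGenInftyO.measurableE R).
  suff : <<s @measurable_realfun.RGenInftyO.G R >> `<=`
      (fun A : set R => K ((fst \o phi) @^-1` A)) by apply.
  apply: smallest_sub.
    split=> [|B|F KF]; [by rewrite /= preimage_set0| | ].
      by move=> KB; rewrite /= setTD preimage_setC; exact: KC'.
    by rewrite /= preimage_bigcup; exact: KU.
  move=> _ [b ->] /=; rewrite (_ : _ @^-1` _ = [set x | Defs.coord (phi x) ord0 < b]) //.
  by apply/seteqP; split => x; rewrite /mkset coordE unlift_none /= in_itv.
have h2 (A : set (Rn R n)) : measurable A -> K ((snd \o phi) @^-1` A).
  apply: (IH (snd \o phi)) => i b; have := Kc (lift ord0 i) b.
  rewrite (_ : [set x | _] = [set x | Defs.coord (n := n) (phi x).2 i < b])//.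
  by apply/seteqP; split => x; rewrite /mkset coordE liftK.
suff : (@measurable _ (Rn R n.+1) : set (set _)) `<=` (fun E => K (phi @^-1` E)) by exact.
apply: smallest_sub.
  split=> [|B|F KF]; [by rewrite /= preimage_set0| | ].
    by move=> KB; rewrite /= setTD preimage_setC; exact: KC'.
  by rewrite /= preimage_bigcup; exact: KU.
by move=> B [[A mA <-]|[A mA <-]]; rewrite setTI; [exact: h1|exact: h2].
Qed.

Context (n : nat).
Implicit Types (P Q S : cube R n) (L : seq (cube R n)) (c : pred (cube R n)).

Lemma vol_gt0 P : 0 < vol P. Proof. by rewrite exprn_gt0 // side_gt0. Qed.

Lemma vol_dil k P : vol (dil k P) = 2 ^+ (k * n) * vol P.
Proof. by rewrite /vol /= exprMn exprM. Qed.

Lemma cunion_cons P L : cunion (P :: L) = cset P `|` cunion L.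
Proof.
apply/seteqP; split=> x.
  move=> [S /=]; rewrite inE => /orP[/eqP->|SL] Sx; first by left.
  by right; exists S.
move=> [Px|[S SL Sx]]; first by exists P => //=; exact: mem_head.
by exists S => //=; rewrite inE SL orbT.
Qed.

Lemma cunion_nil : cunion (Nil (cube R n)) = set0.
Proof. by apply/seteqP; split=> x // []. Qed.

Lemma measurable_cunion L : measurable (cunion L).
Proof.
by elim: L => [|P L IH]; [rewrite cunion_nil|
  rewrite cunion_cons; apply: measurableU => //; exact: measurable_cset].
Qed.

Local Open Scope ereal_scope.

Lemma le_measure_list (I : choiceType) (L : seq I) (F : I -> set (Rn R n))
    (b : I -> \bar R) (E : set (Rn R n)) :
  measurable E -> (forall i, measurable (F i)) ->
  E `<=` \bigcup_(i in [set` L]) F i ->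
  (forall i, i \in L -> leb R n (F i) <= b i) ->
  leb R n E <= \sum_(i <- L) b i.
Proof.
move=> mE mF EF Fb; apply: (@le_trans _ _ (\sum_(i <- L) leb R n (F i))); last first.
  by rewrite big_seq [leRHS]big_seq; exact: lee_sum.
apply: (@le_trans _ _ (leb R n (\big[setU/set0]_(i <- L) F i))).
  apply: le_measure; rewrite ?inE//; first exact: bigsetU_measurable.
  by rewrite -bigcup_seq.
elim: L {EF Fb} => [|i L IH]; first by rewrite !big_nil measure0.
rewrite !big_cons; apply: (le_trans (measureU2 _ _ _)) => //.
  exact: bigsetU_measurable.
by rewrite leeD2l.
Qed.

Lemma measure_children (F : {ffun 'I_n -> bool} -> set (Rn R n)) P :
  (forall e, measurable (F e)) -> (forall e, F e `<=` cset (child P e)) ->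
  leb R n (\bigcup_e F e) = \sum_(e <- enum {ffun 'I_n -> bool}) leb R n (F e).
Proof.
move=> mF FP; rewrite -[in LHS](_ : [set` enum {ffun 'I_n -> bool}] = setT).
  rewrite measure_fin_bigcup //.
    by rewrite -fsbig_seq ?enum_uniq.
  by apply/trivIsetP => e e' _ _ ee'; apply/seteqP; split=> // x [/FP ex /FP e'x];
    move/eqP: ee'; apply; exact: child_disj ex e'x.
by apply/seteqP; split => // e _; rewrite /= mem_enum.
Qed.

Lemma sum_sel c M P :
  \sum_(S <- sel c M P) (vol S)%:E = leb R n (cunion (sel c M P)).
Proof.
elim: M P => [|M IH] P.
  rewrite /=; case: ifPn => _; last by rewrite cunion_nil measure0 big_nil.
  by rewrite cunion_cons cunion_nil setU0 leb_cset big_seq1.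
rewrite selS; case: ifPn => _.
  by rewrite cunion_cons cunion_nil setU0 leb_cset big_seq1.
rewrite (cunion_children (sel c M)) (measure_children (P := P)).
- by rewrite big_flatten big_map; apply: eq_bigr => e _; exact: IH.
- by move=> e; exact: measurable_cunion.
- by move=> e; apply: cunion_sub => S; exact: sel_subc.
Qed.

Lemma sum_lev N P (E : set (Rn R n)) : measurable E ->
  \sum_(S <- lev N P) leb R n (E `&` cset S) = leb R n (E `&` cset P).
Proof.
move=> mE; elim: N P => [|N IH] P; first by rewrite /= big_seq1.
rewrite /= big_flatten big_map /= (eq_bigr _ (fun e _ => IH (child P e))).
rewrite -(measure_children (P := P)).
- congr (leb R n _); rewrite -setI_bigcupr; congr (_ `&` _).
  apply/seteqP; split=> x; last by move=> /child_cover[e ex]; exists e.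
  by move=> [e _]; exact: subc_cset (subc_child P e) _.
- by move=> e; apply: measurableI => //; exact: measurable_cset.
- by move=> e x [].
Qed.

End measure_Rn.

(** * Dyadic differentiation *)

Section dyadic_density.
Context (R : realType) (n : nat).
Implicit Types (P Q S : cube R n) (E D : set (Rn R n)).

Definition dyadic_set N Q D : Prop := forall S, S \in lev N Q ->
  cset S `<=` D \/ cset S `&` D = set0.

Definition dyadic_approx Q E : Prop := measurable E /\
  forall eps : R, 0 < eps -> exists N D, [/\ measurable D, dyadic_set N Q D &
    (leb R n (cset Q `&` (E `+` D)) <= eps%:E)%E].

Lemma dyadic_setD N M Q D : dyadic_set N Q D -> dyadic_set (N + M) Q D.
Proof.
move=> ND S /lev_refine[T TN /subc_cset ST]; have [TD|TD] := ND T TN.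
  by left; exact: subset_trans ST TD.
by right; apply/seteqP; split=> // x [/ST Tx Dx]; rewrite -TD.
Qed.

Lemma dyadic_setC N Q D : dyadic_set N Q D -> dyadic_set N Q (~` D).
Proof.
move=> ND S /ND[SD|SD].
  by right; apply/seteqP; split=> // x [/SD].
by left=> x Sx Dx; rewrite -[False]/(set0 x) -SD.
Qed.

Lemma dyadic_setU N Q D D' : dyadic_set N Q D -> dyadic_set N Q D' ->
  dyadic_set N Q (D `|` D').
Proof.
move=> ND ND' S SN; have [SD|SD] := ND S SN; first by left=> x /SD; left.
have [SD'|SD'] := ND' S SN; first by left=> x /SD'; right.
by right; rewrite setIUr SD SD' setU0.
Qed.

Lemma measurable_setY E D : measurable E -> measurable D -> measurable (E `+` D).
Proof.
by move=> mE mD; rewrite setY_def; apply: measurableU; exact: measurableD.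
Qed.

Lemma leb_setI_fin Q E : measurable E -> (leb R n (cset Q `&` E) \is a fin_num)%E.
Proof.
move=> mE; rewrite ge0_fin_numE //.
apply: (@le_lt_trans _ _ (leb R n (cset Q))); last by rewrite leb_cset ltry.
by apply: le_measure; rewrite ?inE; [apply: measurableI => //| |exact: subIsetl];
  exact: measurable_cset.
Qed.

Lemma dyadic_approxC Q E : dyadic_approx Q E -> dyadic_approx Q (~` E).
Proof.
move=> [mE aE]; split; first exact: measurableC.
move=> eps /aE[N [D [mD ND le]]]; exists N, (~` D); split.
- exact: measurableC.
- exact: dyadic_setC.
- rewrite (_ : ~` E `+` ~` D = E `+` D) //.
  by rewrite !setY_def !setDE !setCK setUC setIC [X in _ `|` X]setIC.
Qed.

Lemma dyadic_approxU Q E E' : dyadic_approx Q E -> dyadic_approx Q E' ->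
  dyadic_approx Q (E `|` E').
Proof.
move=> [mE aE] [mE' aE']; split; first exact: measurableU.
move=> eps e0; have e20 : 0 < eps / 2 by rewrite divr_gt0.
have [N [D [mD ND le]]] := aE _ e20; have [N' [D' [mD' ND' le']]] := aE' _ e20.
exists (N + N')%N, (D `|` D'); split; first exact: measurableU.
  by apply: dyadic_setU; [exact: dyadic_setD|rewrite addnC; exact: dyadic_setD].
apply: (@le_trans _ _ (leb R n ((cset Q `&` (E `+` D)) `|` (cset Q `&` (E' `+` D'))))).
  have mQ := measurable_cset Q.
  apply: le_measure; rewrite ?inE.
  - by apply: measurableI => //; apply: measurable_setY; exact: measurableU.
  - by apply: measurableU; apply: measurableI => //; exact: measurable_setY.
  - rewrite -setIUr; apply: setIS => x; rewrite !setY_def /=.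
    have [] := pselect (E x); have [] := pselect (E' x);
    have [] := pselect (D x); have [] := pselect (D' x); rewrite /setD /=; tauto.
apply: (le_trans (measureU2 _ _ _)).
- by apply: measurableI; [exact: measurable_cset|exact: measurable_setY].
- by apply: measurableI; [exact: measurable_cset|exact: measurable_setY].
- by rewrite [eps]splitr EFinD; exact: leeD.
Qed.

Lemma dyadic_approx_dyadic N Q D : measurable D -> dyadic_set N Q D -> dyadic_approx Q D.
Proof.
move=> mD ND; split=> // eps e0; exists N, D; split => //.
by rewrite setYK setI0 measure0 lee_fin ltW.
Qed.

Lemma dyadic_approx0 Q : dyadic_approx Q set0.
Proof.
by apply: (@dyadic_approx_dyadic 0) => // S _; right; rewrite setI0.
Qed.

Lemma dyadic_approx_bigcup Q (F : (set (Rn R n))^nat) :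
  (forall i, dyadic_approx Q (F i)) -> dyadic_approx Q (\bigcup_i F i).
Proof.
move=> aF; have mF i : measurable (F i) by have [] := aF i.
have mUF : measurable (\bigcup_i F i) by exact: bigcup_measurable.
split=> // eps e0; have e20 : 0 < eps / 2 by rewrite divr_gt0.
pose G m := \big[setU/set0]_(i < m) F i.
have aG m : dyadic_approx Q (G m).
  elim: m => [|m IH]; first by rewrite /G big_ord0; exact: dyadic_approx0.
  by rewrite /G big_ord_recr; exact: dyadic_approxU.
have mG m : measurable (G m) by have [] := aG m.
have mQ := measurable_cset Q.
pose H m := cset Q `&` (\bigcup_i F i `\` G m).
have mH m : measurable (H m) by apply: measurableI => //; exact: measurableD.
have [m Hm] : exists m, (leb R n (H m) <= (eps / 2)%:E)%E.
  apply: contrapT => nH.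
  have Hgt m : ((eps / 2)%:E <= leb R n (H m))%E.
    rewrite leNgt; apply/negP => h; apply: nH; exists m; exact: ltW.
  have H0 : \bigcap_m H m = set0.
    apply/seteqP; split=> // x Hx; have [_ [[i _ Fx] _]] := Hx 0%N I.
    have [_ [_]] := Hx i.+1 I; apply; rewrite /G -bigcup_mkord.
    by exists i => //=.
  have cH : leb R n (H m) @[m --> \oo] --> leb R n (\bigcap_m H m).
    apply: nonincreasing_cvg_mu => //.
    - by rewrite -ge0_fin_numE //; apply: leb_setI_fin; exact: measurableD.
    - exact: bigcap_measurable.
    - move=> k l kl; apply/subsetPset; apply: setIS; apply: setDS.
      by rewrite /G -!bigcup_mkord; apply: bigcup_sub => i /= ik x Fx; exists i => //=;
        exact: leq_trans ik kl.
  have : ((eps / 2)%:E <= limn (fun m => leb R n (H m)))%E.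
    by apply: lime_ge; [apply/cvg_ex; eexists; exact: cH|apply: nearW].
  by rewrite (cvg_lim _ cH) // H0 measure0 lee_fin leNgt e20.
have [_ /(_ _ e20)[N [D [mD ND le]]]] := aG m.
exists N, D; split => //.
apply: (@le_trans _ _ (leb R n (H m `|` (cset Q `&` (G m `+` D))))).
  apply: le_measure; rewrite ?inE.
  - by apply: measurableI => //; exact: measurable_setY.
  - by apply: measurableU => //; apply: measurableI => //; exact: measurable_setY.
  - have GF : G m `<=` \bigcup_i F i.
      by rewrite /G -bigcup_mkord => x [i _ Fx]; exists i.
    rewrite /H -setIUr; apply: setIS => x; rewrite !setY_def.
    move=> [[Fx Dx]|[Dx Fx]]; have [Gx|Gx] := pselect (G m x).
    + by right; left.
    + by left.
    + by have := Fx (GF _ Gx).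
    + by right; right.
apply: (le_trans (measureU2 _ _ _)) => //.
  by apply: measurableI => //; exact: measurable_setY.
by rewrite [eps]splitr EFinD; exact: leeD.
Qed.

Lemma dyadic_approx_halfspace Q (i : 'I_n) (b : R) :
  dyadic_approx Q [set x | Defs.coord x i < b].
Proof.
set E := [set x | _].
have mE : measurable E.
  rewrite (_ : E = setT `&` (fun x => Defs.coord x i) @^-1` `]-oo, b[).
    by apply: measurable_coord => //; exact: measurable_itv.
  by rewrite setTI; apply/seteqP; split=> x /=; rewrite in_itv.
pose L N := [seq S <- lev N Q | `[< cset S `<=` E >]].
have aL N : dyadic_approx Q (cunion (L N)).
  apply: (@dyadic_approx_dyadic N); first exact: measurable_cunion.
  move=> S SN; have [SE|SE] := pselect (cset S `<=` E).
    left => x Sx; exists S => //=; rewrite mem_filter SN andbT.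
    exact/asboolP.
  right; apply/seteqP; split => // x [Sx [T /=]].
  rewrite mem_filter => /andP[/asboolP TE TN] Tx.
  by apply: SE; rewrite (lev_disj SN TN Sx Tx).
have [_ aU] := dyadic_approx_bigcup aL.
split=> // eps /aU[N [D [mD ND le]]]; exists N, D; split=> //.
rewrite (_ : cset Q `&` (E `+` D) = cset Q `&` (\bigcup_N cunion (L N) `+` D)) //.
have LE : \bigcup_N cunion (L N) `<=` E.
  move=> x [M _ [T /=]].
  by rewrite mem_filter => /andP[/asboolP TE TN] /TE.
have EL : cset Q `&` E `<=` \bigcup_N cunion (L N).
  move=> x [Qx Ex]; have d0 : 0 < b - Defs.coord x i by rewrite subr_gt0.
  have [M hM] : exists M, side Q < 2 ^+ M * (b - Defs.coord x i).
    pose M := (Num.truncn (side Q / (b - Defs.coord x i))).+1.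
    exists M; rewrite -ltr_pdivrMr //; apply: (@lt_le_trans _ _ M%:R).
      by rewrite truncnS_gt // divr_ge0 // ltW // side_gt0.
    by rewrite -natrX ler_nat ltnW // ltn_expl.
  have [S SM Sx] := lev_cover M Qx.
  exists M => //; exists S => //=; rewrite mem_filter SM andbT; apply/asboolP => y Sy.
  have sS := lev_side SM; rewrite sS ltr_pM2l ?exprn_gt0 // in hM.
  rewrite /E /=; have /andP[_ y2] := Sy i; have /andP[x1 _] := Sx i.
  by clear -hM y2 x1; lra.
apply/seteqP; split=> x; rewrite !setY_def => -[Qx [[Ex Dx]|[Dx Ex]]]; split=> //.
- by left; split=> //; exact: EL.
- by right; split=> // /LE.
- by left; split=> //; exact: LE.
- by right; split=> // Ex'; apply: Ex; exact: EL.
Qed.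

Lemma measurable_dyadic_approx Q E : measurable E -> dyadic_approx Q E.
Proof.
apply: (@sigma_algebra_coord R (Rn R n) n (dyadic_approx Q) id).
- split; first exact: dyadic_approx0.
  + by move=> A; rewrite setTD; exact: dyadic_approxC.
  + exact: dyadic_approx_bigcup.
- exact: dyadic_approx_halfspace.
Qed.

Local Open Scope ereal_scope.

Lemma dyadic_density0 Q E (theta : R) : measurable E -> E `<=` cset Q ->
  (0 <= theta < 1)%R ->
  (forall N S, S \in lev N Q -> leb R n (E `&` cset S) <= (theta * vol S)%:E) ->
  leb R n E = 0.
Proof.
move=> mE EQ /andP[t0 t1] hE; have mQ := measurable_cset Q.
have EI : cset Q `&` E = E by apply: setIidr.
have fE : leb R n E \is a fin_num by rewrite -EI; exact: leb_setI_fin.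
apply/eqP; rewrite eq_le measure_ge0 andbT leNgt; apply/negP => E0.
pose m := fine (leb R n E); have m0 : (0 < m)%R by rewrite -lte_fin fineK.
have e0 : (0 < m * (1 - theta) / 4)%R by rewrite divr_gt0 // mulr_gt0 // subr_gt0.
have [_ /(_ _ e0)[N [D [mD ND le]]]] := measurable_dyadic_approx Q mE.
set eps := (m * (1 - theta) / 4)%R in e0 le.
have ED : leb R n (E `\` D) <= eps%:E.
  apply: le_trans le; apply: le_measure; rewrite ?inE; first exact: measurableD.
    by apply: measurableI => //; exact: measurable_setY.
  by move=> x [Ex Dx]; split; [exact: EQ|rewrite setY_def; left].
have DQ : leb R n (D `&` cset Q) <= (m + eps)%:E.
  apply: (@le_trans _ _ (leb R n (E `|` (cset Q `&` (E `+` D))))).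
    apply: le_measure; rewrite ?inE; first exact: measurableI.
      by apply: measurableU => //; apply: measurableI => //; exact: measurable_setY.
    move=> x [Dx Qx]; have [Ex|Ex] := pselect (E x); first by left.
    by right; split=> //; rewrite setY_def; right.
  apply: (le_trans (measureU2 _ _ _)) => //.
    by apply: measurableI => //; exact: measurable_setY.
  by rewrite EFinD /m fineK // leeD2l.
have EDQ : leb R n (E `&` D) <= theta%:E * leb R n (D `&` cset Q).
  have -> : E `&` D = (E `&` D) `&` cset Q by apply/esym/setIidl => x [/EQ].
  rewrite -(sum_lev N Q (measurableI _ _ mE mD)) -(sum_lev N Q mD).
  rewrite ge0_sume_distrr; last by move=> S _ /=; rewrite measure_ge0.
  rewrite big_seq [leRHS]big_seq; apply: lee_sum => S SN.
  have [SD|SD] := ND S SN.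
    rewrite -setIA (setIidr SD) leb_cset -EFinM; exact: hE SN.
  by rewrite -setIA [D `&` _]setIC SD setI0 measure0 mule0.
have : leb R n E <= eps%:E + theta%:E * (m + eps)%:E.
  rewrite -(setUIDK E D); apply: (le_trans (measureU2 _ _ _)).
  - exact: measurableI.
  - exact: measurableD.
  rewrite addeC; apply: leeD => //; apply: (le_trans EDQ).
  by apply: lee_wpmul2l.
rewrite -(fineK fE) -EFinM -EFinD lee_fin -/m.
have : (theta * eps <= eps)%R by rewrite ler_piMl // ltW.
rewrite {2 3}/eps => h1 h2.
have : (m * (1 - theta) <= 2 * eps)%R by lra.
rewrite /eps; have : (0 < m * (1 - theta))%R by rewrite mulr_gt0 // subr_gt0.
lra.
Qed.

(* Stands in for the Lebesgue differentiation theorem: it is proved by approximating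
   measurable sets by unions of dyadic cells. *)
Lemma dyadic_differentiation Q (c : pred (cube R n)) (h : Rn R n -> R) (l : R) :
  measurable_fun setT h -> (forall x, (0 <= h x)%R) -> (0 <= l)%R ->
  (forall S, ~~ c S -> \int[leb R n]_(x in cset S) (h x)%:E <= (l * vol S)%:E) ->
  leb R n ((cset Q `&` [set x | (l < h x)%R]) `\` \bigcup_M cunion (sel c M Q)) = 0.
Proof.
move=> mh h0 l0 hc; have mQ := measurable_cset Q.
set U := \bigcup_M _; have mU : measurable U.
  by apply: bigcup_measurable => M _; exact: measurable_cunion.
have mhE D : measurable_fun D (EFin \o h).
  by apply/measurable_EFinP; exact: measurable_funTS.
pose r k : R := (l + k.+1%:R^-1)%R.
have r0 k : (0 < r k)%R by rewrite ltr_wpDl // invr_gt0.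
have mh' (i : interval R) : measurable (h @^-1` [set` i]).
  by rewrite -[X in measurable X]setTI; apply: mh => //; exact: measurable_itv.
pose E k := (cset Q `&` h @^-1` `[r k, +oo[) `\` U.
have mE k : measurable (E k) by apply: measurableD => //; exact: measurableI.
have Ek0 k : leb R n (E k) = 0.
  apply: (@dyadic_density0 Q _ (l / r k)) => //.
  - by move=> x [[]].
  - by rewrite divr_ge0 ?(ltW (r0 k)) //= ltr_pdivrMr // mul1r ltrDl invr_gt0.
  move=> N S SN; have mS := measurable_cset S.
  have [cS|cS] := boolP (c S).
    rewrite (_ : _ `&` _ = set0) ?measure0 ?lee_fin.
      by rewrite mulr_ge0 ?divr_ge0 ?(ltW (r0 k)) ?(ltW (vol_gt0 S)).
    apply/seteqP; split=> // x [[_ Ux] Sx]; apply: Ux.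
    by exists N => //; exact: (lev_sel SN cS).
  have mES : measurable (E k `&` cset S) by exact: measurableI.
  have h1 : (r k)%:E * leb R n (E k `&` cset S) <= (l * vol S)%:E.
    apply: le_trans (hc _ cS); rewrite -integral_cst //.
    apply: (@le_trans _ _ (\int[leb R n]_(x in E k `&` cset S) (h x)%:E)).
      apply: ge0_le_integral => //.
      - by move=> x _; rewrite lee_fin; exact: ltW (r0 k).
      - by move=> x [[[_ +] _] _]; rewrite /= in_itv /= andbT lee_fin.
    apply: (ge0_subset_integral _ mES mS (mhE _)); last by move=> x [].
    by move=> x _; rewrite lee_fin.
  have fS : leb R n (E k `&` cset S) \is a fin_num by rewrite setIC; exact: leb_setI_fin.
  move: h1; rewrite -(fineK fS) -EFinM !lee_fin => h1.
  by rewrite mulrAC ler_pdivlMr // mulrC.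
rewrite (_ : _ `\` _ = \bigcup_k E k).
  apply/eqP; rewrite eq_le measure_ge0 andbT.
  apply: (le_trans (measure_sigma_subadditive (leb R n) (F := E) _ _ (subset_refl _))) => //.
    exact: bigcup_measurable.
  by rewrite eseries0 // => k _ _; exact: Ek0.
apply/seteqP; split=> x.
  move=> [[Qx /= lx] Ux].
  pose k := Num.truncn (h x - l)^-1; exists k => //.
  split=> //; split=> //=; rewrite in_itv /= andbT /r.
  have d0 : (0 < h x - l)%R by rewrite subr_gt0.
  rewrite -lerBrDl -[leRHS]invrK lef_pV2 ?posrE ?invr_gt0 //.
  by rewrite ltW // truncnS_gt // invr_ge0 ltW.
move=> [k _ [[Qx /=]]]; rewrite in_itv /= andbT => rx Ux; split=> //; split=> //=.
by apply: lt_le_trans rx; rewrite ltrDl invr_gt0.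
Qed.

End dyadic_density.

(** * Averages *)

Section powers.
Context (R : realType).
Implicit Types (a b c p r t : R).

Lemma ler_powRl a b p : 0 <= p -> 0 <= a -> a <= b -> a `^ p <= b `^ p.
Proof.
move=> p0 a0 ab; apply: ge0_ler_powR => //; rewrite nnegrE //.
exact: le_trans ab.
Qed.

Lemma powRK a p : 0 < p -> 0 <= a -> (a `^ p) `^ p^-1 = a.
Proof. by move=> p0 a0; rewrite -powRrM mulfV ?gt_eqF // powRr1. Qed.

Lemma powR_invK a p : 0 < p -> 0 <= a -> (a `^ p^-1) `^ p = a.
Proof. by move=> p0 a0; rewrite -powRrM mulVf ?gt_eqF // powRr1. Qed.

Lemma powRVl a p : 0 <= a -> a^-1 `^ p = (a `^ p)^-1.
Proof. by move=> a0; rewrite -(powR_inv1 a0) -powRrM mulN1r powRN. Qed.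

Lemma powRXl a p m : 0 <= a -> (a ^+ m) `^ p = (a `^ p) ^+ m.
Proof.
move=> a0; elim: m => [|m IH]; first by rewrite !expr0 powR1.
by rewrite !exprS powRM ?exprn_ge0 // IH.
Qed.

Lemma powR_split a t p r : 0 <= a -> 0 < t -> 0 < p -> p <= r ->
  a `^ p <= t `^ p + t `^ (p - r) * a `^ r.
Proof.
move=> a0 t0 p0 pr; have [at_|ta] := leP a t.
  apply: (le_trans (ler_powRl (ltW p0) a0 at_)).
  by rewrite lerDl mulr_ge0 ?powR_ge0.
have a0' : 0 < a by exact: lt_trans ta.
apply: (@le_trans _ _ (t `^ (p - r) * a `^ r)); last by rewrite lerDr powR_ge0.
rewrite -[in leLHS](subrK r p) [in leLHS]powRD; last by rewrite (gt_eqF a0') implybT.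
rewrite ler_wpM2r ?powR_ge0 // -(opprB r p) !powRN lef_pV2 ?posrE ?powR_gt0 //.
by apply: ler_powRl; rewrite ?subr_ge0 // ltW.
Qed.

Lemma powR_sum3 a b c p : 0 <= p ->
  `|a + b + c| `^ p <= 3 `^ p * (`|a| `^ p + `|b| `^ p + `|c| `^ p).
Proof.
move=> p0.
suff : exists m : R, [/\ `|a + b + c| <= 3 * m, 0 <= m &
    m `^ p <= `|a| `^ p + `|b| `^ p + `|c| `^ p].
  move=> [m [abc m0 mp]]; apply: (@le_trans _ _ ((3 * m) `^ p)).
    exact: ler_powRl.
  by rewrite powRM // ler_wpM2l ?powR_ge0.
have h : `|a + b + c| <= `|a| + `|b| + `|c|.
  by rewrite (le_trans (ler_normD _ _)) // lerD2r ler_normD.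
have a0 := powR_ge0 `|a| p; have b0 := powR_ge0 `|b| p.
have c0 := powR_ge0 `|c| p.
have [ab|ba] := leP `|a| `|b|.
  have [bc|cb] := leP `|b| `|c|.
    by exists `|c|; split; [lra|exact: normr_ge0|lra].
  by exists `|b|; split; [lra|exact: normr_ge0|lra].
have [ac|ca] := leP `|a| `|c|.
  by exists `|c|; split; [lra|exact: normr_ge0|lra].
by exists `|a|; split; [lra|exact: normr_ge0|lra].
Qed.

End powers.

Section averages.
Context (R : realType) (n : nat).
Implicit Types (P Q S : cube R n) (g u : Rn R n -> R) (c p q r : R).
Local Open Scope ereal_scope.

Definition lpint p Q g : \bar R := \int[leb R n]_(x in cset Q) (`|g x| `^ p)%:E.

Lemma measurable_normpow p g (D : set (Rn R n)) : measurable_fun setT g ->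
  measurable_fun D (fun x => (`|g x| `^ p)%:E).
Proof.
move=> mg; apply/measurable_EFinP/measurable_funTS.
apply: (measurableT_comp (measurable_powR p)).
by apply: (measurableT_comp _ mg); exact: normr_measurable.
Qed.

Lemma lpint_ge0 p Q g : 0 <= lpint p Q g.
Proof. by apply: integral_ge0 => x _; rewrite lee_fin powR_ge0. Qed.

Lemma lpint_subset p P Q g : measurable_fun setT g -> cset P `<=` cset Q ->
  lpint p P g <= lpint p Q g.
Proof.
move=> mg PQ; apply: ge0_subset_integral => //; try exact: measurable_cset.
exact: measurable_normpow.
Qed.

Lemma avgp_le p Q g c : (0 < p)%R -> (0 <= c)%R ->
  (avgp p Q g <= c%:E) <-> (lpint p Q g <= (c `^ p * vol Q)%:E).
Proof.
move=> p0 c0; rewrite /avgp -/(lpint p Q g).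
have v0 := vol_gt0 Q; have l0 := lpint_ge0 p Q g.
have vl0 : 0 <= ((vol Q)^-1)%:E * lpint p Q g.
  by rewrite mule_ge0 // lee_fin invr_ge0 ltW.
have e0 : (0 <= p^-1)%R by rewrite invr_ge0 ltW.
rewrite mulrC EFinM -lee_pdivrMl //.
split=> h.
  have : ((((vol Q)^-1)%:E * lpint p Q g) `^ p^-1) `^ p <= c%:E `^ p.
    by apply: gt0_ler_poweR; rewrite ?in_itv/= ?leey ?andbT ?poweR_ge0 ?lee_fin // ltW.
  by rewrite -poweRrM mulVf ?gt_eqF // poweRe1 // poweR_EFin.
rewrite -[leRHS](_ : ((c `^ p)%:E `^ p^-1) = _); last by rewrite poweR_EFin powRK.
by apply: gt0_ler_poweR; rewrite ?in_itv/= ?leey ?andbT ?lee_fin ?powR_ge0.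
Qed.

(* Only some finite exponent beyond q is needed, so q0 = +oo is replaced by q + 1. *)
Definition finexp q (q0 : \bar R) : R := if q0 is r%:E then r else (q + 1)%R.

Lemma esssup_on_lpint r Q u c c' : (0 <= r)%R -> measurable_fun setT u ->
  esssup_on Q u <= c%:E -> (c < c')%R -> lpint r Q u <= (c' `^ r * vol Q)%:E.
Proof.
move=> r0 mu uc cc'; have mQ := measurable_cset Q.
have /ereal_inf_lt[y yae yc'] : esssup_on Q u < c'%:E by apply: le_lt_trans uc _.
rewrite EFinM -leb_cset -integral_cst //.
apply: (ae_ge0_le_integral mQ _ (measurable_normpow r (D := _) mu) _
  (measurable_cst _)).
- by move=> x _; rewrite lee_fin powR_ge0.
- by move=> x _; rewrite /= lee_fin powR_ge0.
- move: yae; apply: filterS => x hx Qx; rewrite lee_fin; apply: ler_powRl => //.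
  by rewrite -lee_fin; apply: le_trans (hx Qx) (ltW _).
Qed.

Lemma avgq_le q (q0 : \bar R) Q u c c' : (0 < q)%R -> q%:E < q0 ->
  measurable_fun setT u -> (0 <= c)%R -> (c < c')%R ->
  avgq q0 Q u <= c%:E -> lpint (finexp q q0) Q u <= (c' `^ finexp q q0 * vol Q)%:E.
Proof.
move=> q_gt0; case: q0 => [r||] //= qr mu c0 cc' h.
- have r0 : (0 < r)%R by rewrite lte_fin in qr; exact: lt_trans qr.
  apply: (proj1 (avgp_le _ _ r0 _)); first by rewrite ltW // (le_lt_trans c0).
  by apply: le_trans h _; rewrite lee_fin ltW.
- by apply: esssup_on_lpint mu h cc'; rewrite addr_ge0 // ltW.
Qed.

Lemma finexp_gt q (q0 : \bar R) : q%:E < q0 -> (q < finexp q q0)%R.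
Proof. by case: q0 => //= _; rewrite ltrDl. Qed.

End averages.

(** * The good-lambda inequality *)

Section good_lambda.
Context (R : realType) (n : nat).
Implicit Types (P Q S : cube R n) (L : seq (cube R n)) (g u : Rn R n -> R).
Local Open Scope ereal_scope.

(* The average is taken over 2P and not over P: the dilates 2^k S of a selected cube S
   lie in 2P for its k-th dyadic ancestor P, but in no dyadic cube. *)
Definition crit (p t : R) g P : bool :=
  `[< (t `^ p * vol (dil 1 P))%:E < lpint p (dil 1 P) g >].

Lemma sum_integral_disj L (h : Rn R n -> \bar R) :
  measurable_fun setT h -> (forall x, 0 <= h x) -> pairwise (@disj_dil R n) L ->
  \sum_(P <- L) \int[leb R n]_(x in cset (dil 1 P)) h x =
  \int[leb R n]_(x in cunion (map (dil 1) L)) h x.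
Proof.
move=> mh h0; elim: L => [|P L IH]; first by rewrite big_nil cunion_nil integral_set0.
rewrite pairwise_cons => /andP[/allP PL dL].
rewrite big_cons /= cunion_cons ge0_integral_setU ?IH //.
- exact: measurable_cset.
- exact: measurable_cunion.
- exact: measurable_funTS.
- apply/disj_setPS => x [Px [S' /= /mapP[S SL ->] Sx]].
  by have /asboolP PS := PL S SL; rewrite -[False]/(set0 x) -PS.
Qed.

Lemma vitali_measure L (b : cube R n -> \bar R) :
  (forall P, 0 <= b P) ->
  (forall P, P \in L -> (vol (dil 1 P))%:E <= b P) ->
  exists L', [/\ {subset L' <= L}, pairwise (@disj_dil R n) L' &
    leb R n (cunion L) <= (4 ^+ n)%:E * \sum_(P <- L') b P].
Proof.
move=> b0 Lb; have [L' [L'L dL' cL']] := vitali_cubes L.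
exists L'; split => //; rewrite ge0_sume_distrr//.
apply: (le_measure_list (F := fun P => cset (dil 3 P))) => //.
- exact: measurable_cunion.
- by move=> P; exact: measurable_cset.
- move=> P PL'; rewrite leb_cset.
  apply: (@le_trans _ _ ((4 ^+ n)%:E * (vol (dil 1 P))%:E)); last first.
    by apply: lee_wpmul2l; [rewrite lee_fin exprn_ge0|exact: Lb (L'L _ PL')].
  rewrite -EFinM lee_fin !vol_dil mulrA mul1n -exprMn_comm; last exact: mulrC.
  by rewrite exprM (_ : 2 ^+ 3 = 4 * 2)%R //; ring.
Qed.

Lemma good_lambda_cube p r (Q : cube R n) (T e d : R) g u1 u2 u3 L :
  (1 <= p)%R -> (p <= r)%R -> (0 < T)%R -> (0 <= e)%R -> (0 <= d)%R ->
  measurable_fun setT g -> measurable_fun setT u1 ->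
  measurable_fun setT u2 -> measurable_fun setT u3 ->
  {ae leb R n, forall x, cset (dil 1 Q) x -> g x = (u1 x + u2 x + u3 x)%R} ->
  lpint p (dil 1 Q) u1 <= ((e * T) `^ p * vol (dil 1 Q))%:E ->
  lpint r (dil 1 Q) u2 <= ((d * T) `^ r * vol (dil 1 Q))%:E ->
  lpint r (dil 1 Q) u3 <= ((d * T) `^ r * vol (dil 1 Q))%:E ->
  (forall P, P \in L -> crit p T g P /\ subc P Q) ->
  leb R n (cunion L) <=
    (8 ^+ n * (2 * 3 `^ p) * (e `^ p + 2 * 12^-1 `^ (p - r) * d `^ r) * vol Q)%:E.
Proof.
move=> p1 pr T0 e0 d0 mg mu1 mu2 mu3 gu hu1 hu2 hu3 hL.
have p0 : (0 < p)%R by exact: lt_le_trans p1.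
(* With tau = T / 12 the part of g below tau costs at most half of T `^ p. *)
pose tau : R := (12^-1 * T)%R; have tau0 : (0 < tau)%R by rewrite mulr_gt0 // invr_gt0.
pose w : R := (tau `^ (p - r))%R; have w0 : (0 <= w)%R by exact: powR_ge0.
pose h x : R := (`|u1 x| `^ p + (w * `|u2 x| `^ r + w * `|u3 x| `^ r))%R.
have h0 x : (0 <= h x)%R by rewrite /h !addr_ge0 ?mulr_ge0 ?powR_ge0.
have mpow (s : R) (v : Rn R n -> R) : measurable_fun setT v ->
    measurable_fun setT (fun x => `|v x| `^ s)%R.
  by move=> /(measurable_normpow s (D := setT))/measurable_EFinP.
have mh : measurable_fun setT h.
  apply: measurable_funD; first exact: mpow.
  by apply: measurable_funD; apply: measurable_funM => //; exact: mpow.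
have mhE (D : set (Rn R n)) : measurable_fun D (EFin \o h).
  by apply/measurable_EFinP; exact: measurable_funTS.
have gh : {ae leb R n, forall x, cset (dil 1 Q) x ->
    (`|g x| `^ p <= 3 `^ p * (h x + 2 * tau `^ p))%R}.
  move: gu; apply: filterS => x gx /gx ->.
  apply: (le_trans (powR_sum3 _ _ _ (ltW p0))); rewrite ler_wpM2l ?powR_ge0 //.
  have := powR_split (normr_ge0 (u2 x)) tau0 p0 pr.
  have := powR_split (normr_ge0 (u3 x)) tau0 p0 pr.
  by rewrite /h /w; lra.
have htau : (3 `^ p * (2 * tau `^ p) <= T `^ p / 2)%R.
  rewrite mulrCA -powRM ?(ltW tau0) // /tau mulrA (_ : 3 * 12^-1 = 4^-1 :> R)%R; last by lra.
  rewrite powRM ?invr_ge0 ?(ltW T0) // mulrA mulrC ler_wpM2l ?powR_ge0 //.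
  apply: (@le_trans _ _ (2 * 4^-1)%R); last by lra.
  by rewrite ler_wpM2l // ge1r_powR // invr_gt0 // ltr0n /= invf_le1 // ler1n.
pose s : R := (T `^ p / (2 * 3 `^ p))%R.
have T0p : (0 < T `^ p)%R by exact: powR_gt0.
have t3p : (0 < 3 `^ p :> R)%R by exact: powR_gt0.
have s0 : (0 < s)%R by rewrite divr_gt0 // mulr_gt0.
pose H P := \int[leb R n]_(x in cset (dil 1 P)) (h x)%:E.
have H0 P : 0 <= H P by apply: integral_ge0 => x _; rewrite lee_fin.
have HL P : P \in L -> (vol (dil 1 P))%:E <= (s^-1)%:E * H P.
  move=> /hL[/asboolP cP PQ]; rewrite lee_pdivlMl //.
  have mP := measurable_cset (dil 1 P).
  have PQ1 := subc_cset (subc_dil 1 PQ).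
  have : lpint p (dil 1 P) g <=
      (3 `^ p)%:E * (H P + (2 * tau `^ p)%:E * (vol (dil 1 P))%:E).
    have c0 : (0 <= 2 * tau `^ p)%R by rewrite mulr_ge0 ?powR_ge0.
    have mF : measurable_fun (cset (dil 1 P))
        ((EFin \o h) \+ cst (2 * tau `^ p)%:E).
      by apply: emeasurable_funD; [exact: mhE|exact: measurable_cst].
    have -> : H P + (2 * tau `^ p)%:E * (vol (dil 1 P))%:E =
        \int[leb R n]_(x in cset (dil 1 P)) ((EFin \o h) \+ cst (2 * tau `^ p)%:E) x.
      rewrite (ge0_integralD _ mP _ (mhE _) _ (measurable_cst _)) /=.
      - by rewrite integral_cst // leb_cset.
      - by move=> x _; rewrite lee_fin.
      - by move=> x _; rewrite lee_fin.
    rewrite -(ge0_integralZl_EFin _ mP _ mF (ltW t3p)); last first.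
      by move=> x _; rewrite /= -EFinD lee_fin addr_ge0.
    apply: (ae_ge0_le_integral mP _ (measurable_normpow p (D := _) mg) _
      (measurable_funeM _ mF)).
    - by move=> x _; rewrite lee_fin powR_ge0.
    - by move=> x _; rewrite /= -EFinD -EFinM lee_fin;
        apply: mulr_ge0; [exact: powR_ge0|exact: addr_ge0].
    - move: gh; apply: filterS => x gx Px.
      by rewrite /= -EFinD -EFinM lee_fin; exact: gx (PQ1 _ Px).
  move=> /(lt_le_trans cP); rewrite -EFinM; have := H0 P.
  have v0 := vol_gt0 (dil 1 P).
  case: (H P) => [y|_ _|//]; last by rewrite leey.
  rewrite -EFinD -EFinM lte_fin !lee_fin => y0 hy.
  rewrite /s mulrAC ler_pdivrMr ?mulr_gt0 //.
  have := ler_wpM2r (ltW v0) htau; lra.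
have [||L' [L'L dL' le]] := @vitali_measure L (fun P => (s^-1)%:E * H P).
- by move=> P; rewrite mule_ge0 // lee_fin invr_ge0 ltW.
- exact: HL.
apply: (le_trans le); rewrite -ge0_sume_distrr //.
have L'Q P : P \in L' -> subc P Q by move=> /L'L /hL[].
have sumH : \sum_(P <- L') H P <= H Q.
  have hE0 x : 0 <= (EFin \o h) x by rewrite lee_fin.
  have -> : \sum_(P <- L') H P = \int[leb R n]_(x in cunion (map (dil 1) L')) (EFin \o h) x
    := sum_integral_disj (mhE _) hE0 dL'.
  apply: (ge0_subset_integral _ (measurable_cunion _) (measurable_cset _) (mhE _)) => //.
  by apply: cunion_sub => P1 /mapP[P PL' ->]; apply: subc_dil; exact: L'Q.
have HQ : H Q <= (((e * T) `^ p + 2 * w * (d * T) `^ r) * vol (dil 1 Q))%:E.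
  have mQ := measurable_cset (dil 1 Q).
  have -> : H Q = \int[leb R n]_(x in cset (dil 1 Q)) ((`|u1 x| `^ p)%:E +
      (w%:E * (`|u2 x| `^ r)%:E + w%:E * (`|u3 x| `^ r)%:E)).
    by apply: eq_integral => x _; rewrite /h !EFinD !EFinM.
  have mw (v : Rn R n -> R) : measurable_fun setT v ->
      measurable_fun (cset (dil 1 Q)) (fun x => w%:E * (`|v x| `^ r)%:E).
    by move=> mv; apply: measurable_funeM; exact: measurable_normpow.
  have w0' (v : Rn R n -> R) x : 0 <= w%:E * (`|v x| `^ r)%:E.
    by rewrite -EFinM lee_fin mulr_ge0 ?powR_ge0.
  rewrite (ge0_integralD _ mQ (f1 := fun x => (`|u1 x| `^ p)%:E)); last 4 first.
  - by move=> x _; rewrite lee_fin powR_ge0.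
  - exact: measurable_normpow.
  - by move=> x _; rewrite adde_ge0.
  - by apply: emeasurable_funD; exact: mw.
  rewrite (ge0_integralD _ mQ (fun x _ => w0' u2 x) (mw _ mu2)
    (fun x _ => w0' u3 x) (mw _ mu3)).
  have Zw (v : Rn R n -> R) : measurable_fun setT v ->
    \int[leb R n]_(x in cset (dil 1 Q)) (w%:E * (`|v x| `^ r)%:E) =
    w%:E * lpint r (dil 1 Q) v.
    move=> mv; rewrite (ge0_integralZl_EFin _ mQ _ (measurable_normpow r (D := _) mv) w0) //.
  rewrite !Zw //.
  apply: (@le_trans _ _ (((e * T) `^ p * vol (dil 1 Q))%:E +
    (w%:E * ((d * T) `^ r * vol (dil 1 Q))%:E +
     w%:E * ((d * T) `^ r * vol (dil 1 Q))%:E))).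
    apply: leeD => //; apply: leeD; apply: lee_wpmul2l => //.
  by rewrite -!EFinM -!EFinD lee_fin; lra.
apply: (@le_trans _ _ ((4 ^+ n)%:E * ((s^-1)%:E *
   (((e * T) `^ p + 2 * w * (d * T) `^ r) * vol (dil 1 Q))%:E))).
  apply: lee_wpmul2l; first by rewrite lee_fin exprn_ge0.
  apply: lee_wpmul2l; first by rewrite lee_fin invr_ge0 ltW.
  exact: le_trans sumH HQ.
rewrite -!EFinM lee_fin vol_dil mul1n /s invf_div.
have -> : ((e * T) `^ p + 2 * w * (d * T) `^ r =
   T `^ p * (e `^ p + 2 * 12^-1 `^ (p - r) * d `^ r))%R.
  rewrite !powRM ?(ltW T0) // /w /tau powRM ?invr_ge0 ?(ltW T0) //.
  have -> : (T `^ p = T `^ (p - r) * T `^ r)%R.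
    by rewrite -powRD ?subrK // gt_eqF // implybT.
  ring.
have h8 : (8 ^+ n = 4 ^+ n * 2 ^+ n :> R)%R.
  by rewrite -exprMn; congr (_ ^+ n)%R; lra.
rewrite h8; set X := (e `^ p + _)%R; set Y := (4 ^+ n)%R; set Z := (2 ^+ n)%R.
rewrite le_eqVlt; apply/orP; left; apply/eqP; field.
by rewrite gt_eqF.
Qed.

End good_lambda.

Section operators.
Context (R : realType) (n : nat).
Implicit Types (P Q S : cube R n) (f g u : Rn R n -> R).

Lemma cset_sub_dil P Q : exists k, cset P `<=` cset (dil k Q).
Proof.
pose M := \sum_i `|corner P i - corner Q i| + side P + side Q.
have P0 := side_gt0 P; have Q0 := side_gt0 Q.
have [k hk] : exists k, 2 * M < 2 ^+ k * side Q.
  exists (Num.truncn (2 * M / side Q)).+1; rewrite -ltr_pdivrMr //.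
  have M0 : 0 <= 2 * M / side Q.
    by rewrite divr_ge0 ?mulr_ge0 ?addr_ge0 ?sumr_ge0 // ltW.
  apply: (@lt_le_trans _ _ (Num.truncn (2 * M / side Q)).+1%:R).
    by rewrite truncnS_gt.
  by rewrite -natrX ler_nat ltnW // ltn_expl.
exists k => x Px i; have /andP[x1 x2] := Px i.
have hi : `|corner P i - corner Q i| + side P + side Q <= M.
  by rewrite /M !lerD2r (bigD1 i) //= lerDl sumr_ge0.
have [h1 h2] : corner P i - corner Q i <= `|corner P i - corner Q i| /\
    - `|corner P i - corner Q i| <= corner P i - corner Q i.
  by rewrite ler_norm lerNl -normrN ler_norm.
by apply/andP; split => /=; move: hk hi h1 h2 x1 x2; lra.
Qed.

Lemma Lploc_dil p Q g : measurable_fun setT g ->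
  (forall k, (lpint p (dil k Q) g < +oo)%E) -> Lploc p g.
Proof.
move=> mg gQ; split=> // P; have [k Pk] := cset_sub_dil P Q.
by apply: le_lt_trans (gQ k); exact: lpint_subset.
Qed.

Lemma measurable_restr (E : set (Rn R n)) g : measurable E ->
  measurable_fun setT g -> measurable_fun setT (restr E g).
Proof.
by move=> mE mg; apply: measurable_funM => //; exact: measurable_indic.
Qed.

Lemma Lploc_restr p (E : set (Rn R n)) g : 0 <= p -> measurable E ->
  Lploc p g -> Lploc p (restr E g).
Proof.
move=> p0 mE [mg gP]; have mr := measurable_restr mE mg; split=> // P.
apply: le_lt_trans (gP P); have mP := measurable_cset P.
apply: ge0_le_integral => //; try exact: measurable_normpow.
move=> x _; rewrite lee_fin; apply: ler_powRl => //.
rewrite /restr normrM indicE; case: (x \in E) => /=.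
  by rewrite normr1 mul1r.
by rewrite normr0 mul0r.
Qed.

Lemma Lploc_scale p (c : R) g : 0 < p -> Lploc p g -> Lploc p (fun x => c * g x).
Proof.
move=> p0 [mg gP]; split=> [|P]; first by apply: measurable_funM.
rewrite (_ : (\int[_]_(x in _) _)%E = ((`|c| `^ p)%:E * lpint p P g)%E).
  by rewrite lte_mul_pinfty ?lee_fin ?powR_ge0 //; exact: gP.
rewrite -(ge0_integralZl_EFin _ (measurable_cset P) _ (measurable_normpow p (D := _) mg)).
- by apply: eq_integral => x _; rewrite normrM powRM // EFinM.
- by move=> x _; rewrite lee_fin powR_ge0.
- exact: powR_ge0.
Qed.

(* The identity A_S A_Q f = A_Q f says that B_S (B_Q f) = B_S f on 2S. *)
Lemma decomposition p (B : cube R n -> (Rn R n -> R) -> (Rn R n -> R))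
    S Q f (E : set (Rn R n)) :
  0 < p -> linear_on_Lploc p B -> Lploc p f -> Lploc p (B Q f) -> measurable E ->
  {ae leb R n, forall x, cset (dil 1 S) x ->
     Aop B S (Aop B Q f) x = Aop B Q f x} ->
  {ae leb R n, forall x, cset (dil 1 S) x -> B Q f x =
     B S f x + Aop B S (restr E (B Q f)) x + Aop B S (restr (~` E) (B Q f)) x}.
Proof.
move=> p0 hlin Lf Lg mE hA; set g := B Q f in Lg hA *.
have [mB [eB [addB scB]]] := hlin S.
have LNg := Lploc_scale (-1) p0 Lg.
have Lg1 := Lploc_restr (ltW p0) mE Lg.
have Lg2 := Lploc_restr (ltW p0) (measurableC mE) Lg.
have gE : g = (fun x => restr E g x + restr (~` E) g x).
  apply/funext => x; rewrite /restr !indicE in_setC.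
  by case: (x \in E) => /=; rewrite ?mul1r ?mul0r ?addr0 ?add0r.
have Ae : Aop B Q f = (fun x => f x + -1 * g x).
  by apply/funext => x; rewrite /Aop -/g mulN1r.
have h1 := addB _ _ Lf LNg; have h2 := scB (-1) _ Lg; have h3 := addB _ _ Lg1 Lg2.
rewrite -gE in h3.
apply: (filterS2 _ _ hA (filterI (filterI h1 h2) h3)) => x {}hA [[e1 e2] e3] Sx.
have := hA Sx; rewrite {1}/Aop Ae e1 e2 /Aop.
have gx : g x = restr E g x + restr (~` E) g x by rewrite [in LHS]gE.
rewrite e3; move: gx; set g1 := restr E g x; set g2 := restr _ g x.
set b1 := B S _ x; set b2 := B S _ x; set b3 := B S _ x; move=> ->; lra.
Qed.

End operators.

Section series.
Context (R : realType).
Implicit Types (u : nat -> \bar R).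
Local Open Scope ereal_scope.

Lemma nneseries_le u N c : (forall k, (N <= k)%N -> 0 <= u k) ->
  (forall m, \sum_(N <= k < m) u k <= c) -> \sum_(N <= k <oo) u k <= c.
Proof.
move=> u0 uc; apply: lime_le; last exact: nearW.
by apply: is_cvg_nneseries => k Nk _; exact: u0.
Qed.

Lemma nneseries_shift_le u c : (forall k, (2 <= k)%N -> 0 <= u k) ->
  (forall m, \sum_(2 <= k < m) u k <= c) ->
  u 2%N <= c /\ \sum_(2 <= k <oo) u (k + 1)%N <= c.
Proof.
move=> u0 uc; split; first by have := uc 3%N; rewrite big_nat1.
apply: nneseries_le => [k k2|m]; first by apply: u0; rewrite addn1 ltnW.
apply: le_trans (uc m.+1).
have [m2|m2] := leqP m 2; first rewrite big_geq // big_nat_cond.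
  by rewrite sume_ge0 // => k /andP[/andP[k2 _] _]; exact: u0.
rewrite [leRHS]big_ltn; last by rewrite ltnW.
rewrite big_add1 /=; under [in leRHS]eq_bigr do rewrite -addn1.
by rewrite leeDr //; exact: u0.
Qed.

End series.

Section averages_descendants.
Context (R : realType) (n : nat).
Implicit Types (P Q S : cube R n) (g : Rn R n -> R).

Definition two_pow (p : R) (k : nat) : R := 2 `^ (k%:R * n%:R / p).

Lemma two_powK p k : 0 < p -> two_pow p k `^ p = 2 ^+ (k * n).
Proof.
by move=> p0; rewrite /two_pow -powRrM mulfVK ?gt_eqF // -natrM powR_mulrn.
Qed.

Lemma two_pow_ge1 p k : 0 < p -> 1 <= two_pow p k.
Proof.
move=> p0; rewrite -[leLHS](powRr0 2); apply: ler_powR; first by rewrite ler1n.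
by rewrite divr_ge0 ?mulr_ge0 // ltW.
Qed.

Lemma avgp_dil_ancestor p g t Q S N (a : nat -> R) :
  0 < p -> 0 <= t -> measurable_fun setT g -> (forall k, 0 <= a k) ->
  (forall k, (avgp p (dil k Q) g <= (a k)%:E)%E) ->
  subc S Q -> side Q = 2 ^+ N * side S ->
  (forall k, (1 <= k <= N)%N ->
     exists A, [/\ side A = 2 ^+ k * side S, subc S A & ~~ crit p t g A]) ->
  forall k, (1 <= k)%N ->
  (avgp p (dil k S) g <= (two_pow p 1 * t + two_pow p k * a k)%:E)%E.
Proof.
move=> p0 t0 mg a0 hQ SQ sQ hA k k1.
have t1 : 0 <= two_pow p 1 * t by rewrite mulr_ge0 ?powR_ge0.
have t2 : 0 <= two_pow p k * a k by rewrite mulr_ge0 ?powR_ge0.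
have [kN|Nk] := leqP k N.
  apply: (@le_trans _ _ (two_pow p 1 * t)%:E); last by rewrite lee_fin lerDl.
  have [A [sA SA cA]] := hA k (introT andP (conj k1 kN)).
  apply/avgp_le => //.
  apply: (le_trans (lpint_subset p mg (subc_cset (subc_dil_anc SA sA)))).
  have : (lpint p (dil 1 A) g <= (t `^ p * vol (dil 1 A))%:E)%E.
    by rewrite leNgt; apply: contra cA => h; apply/asboolP.
  move=> /le_trans; apply; rewrite lee_fin powRM ?powR_ge0 // two_powK // vol_dil mul1n.
  rewrite /vol /= sA le_eqVlt; apply/orP; left; apply/eqP; ring.
apply: (@le_trans _ _ (two_pow p k * a k)%:E); last by rewrite lee_fin lerDr.
apply/avgp_le => //.
apply: (le_trans (lpint_subset p mg (subc_cset (subc_dil k SQ)))).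
apply: (le_trans (proj1 (avgp_le _ _ p0 (a0 k)) (hQ k))).
rewrite lee_fin powRM ?powR_ge0 // two_powK // !vol_dil [vol Q]/vol sQ exprMn -exprM.
rewrite -/(vol S) mulrCA [leRHS]mulrAC mulrA [leRHS]mulrC.
have h : 2 ^+ (N * n) <= 2 ^+ (k * n) :> R.
  by rewrite ler_weXn2l ?ler1n // leq_mul2r ltnW // orbT.
have c0 : 0 <= a k `^ p * (2 ^+ (k * n) * vol S).
  apply: mulr_ge0; first exact: powR_ge0.
  by apply: mulr_ge0; [exact: exprn_ge0|exact: ltW (vol_gt0 S)].
have := ler_wpM2l c0 h; lra.
Qed.

Lemma sum_avgp_dil p (alpha : nat -> R) g t Q S N (a : nat -> R) (Sm A : R) :
  0 < p -> 0 <= t -> measurable_fun setT g -> (forall k, 0 <= a k) ->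
  (forall k, (avgp p (dil k Q) g <= (a k)%:E)%E) ->
  subc S Q -> side Q = 2 ^+ N * side S ->
  (forall k, (1 <= k <= N)%N ->
     exists A, [/\ side A = 2 ^+ k * side S, subc S A & ~~ crit p t g A]) ->
  (forall k, (2 <= k)%N -> 0 <= alpha k) ->
  (forall m, \sum_(2 <= k < m) two_pow p k * alpha k <= Sm) ->
  (forall m, \sum_(2 <= k < m) alpha k * two_pow p k * a k <= A) -> A <= t ->
  forall m, (\sum_(2 <= k < m) ((alpha k)%:E * avgp p (dil k S) g) <=
    ((two_pow p 1 * Sm + 1) * t)%:E)%E.
Proof.
move=> p0 t0 mg a0 hQ SQ sQ hA al0 hSm hAm At m.
have avg := avgp_dil_ancestor p0 t0 mg a0 hQ SQ sQ hA.
apply: (@le_trans _ _ (\sum_(2 <= k < m)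
   (two_pow p 1 * t * (two_pow p k * alpha k) + alpha k * two_pow p k * a k)%:E)%E).
  rewrite big_nat_cond [leRHS]big_nat_cond.
  apply: lee_sum => k /andP[/andP[k2 _] _].
  apply: (@le_trans _ _ ((alpha k)%:E * (two_pow p 1 * t + two_pow p k * a k)%:E)%E).
    by apply: lee_wpmul2l; [rewrite lee_fin al0|apply: avg; rewrite ltnW].
  rewrite -EFinM lee_fin.
  have h : alpha k <= two_pow p k * alpha k by rewrite ler_peMl ?al0 // two_pow_ge1.
  have c0 : 0 <= two_pow p 1 * t by rewrite mulr_ge0 ?powR_ge0.
  have := ler_wpM2l c0 h; lra.
rewrite sumEFin lee_fin big_split /= -mulr_sumr mulrDl mul1r; apply: lerD.
  by rewrite mulrAC ler_wpM2r // ler_wpM2l ?powR_ge0.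
exact: le_trans (hAm m) At.
Qed.

End averages_descendants.

Section Dq_list.
Context (R : realType) (n : nat).
Implicit Types (P Q S : cube R n) (L : seq (cube R n)).

Lemma Dq_disj q (a : cube R n -> R) C L Q : Dq_with q a C ->
  pairwise (@disj_dil R n) L -> (forall P, P \in L -> subc P Q) ->
  (\sum_(P <- L) (a (dil 1 P) `^ q * vol (dil 1 P))%:E <=
   ((C * a (dil 1 Q)) `^ q * vol (dil 1 Q))%:E)%E.
Proof.
move=> hD dL LQ; pose F (i : 'I_(size L)) := dil 1 (nth Q L i).
have dF (i j : 'I_(size L)) : (i < j)%N -> cset (F i) `&` cset (F j) = set0.
  by move=> ij; apply/asboolP; move/pairwiseP: dL => /(_ Q i j); apply => //;
    rewrite inE.
have := hD (dil 1 Q) _ F.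
rewrite (esum_fset finite_finset); last first.
  by move=> i _; rewrite lee_fin mulr_ge0 ?powR_ge0 // ltW // vol_gt0.
rewrite -[X in \sum_(i \in X) _](_ : [set` enum 'I_(size L)] = _); last first.
  by apply/seteqP; split=> // i _; rewrite /= mem_enum.
rewrite -fsbig_seq ?enum_uniq // big_enum /= => h.
rewrite (big_nth Q) big_mkord; apply: h => [i j ij|i].
  have /orP[ij'|ij'] : (i < j)%N || (j < i)%N.
      by rewrite -neq_ltn; apply/eqP => /val_inj.
    exact: dF.
  by rewrite setIC; exact: dF.
by apply: subc_cset; apply: subc_dil; apply: LQ; exact: mem_nth.
Qed.

End Dq_list.

Lemma good_lambda_constants (R : realType) (p q r c1 c2 d : R) :
  0 < p -> q < r -> 0 <= c1 -> 0 <= c2 -> 0 <= d ->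
  exists K e : R, [/\ 2 <= K, 0 < e &
    K `^ q * (c1 * ((e / K) `^ p + c2 * (d / K) `^ r)) <= 2^-1].
Proof.
move=> p0 qr c10 c20 d0; have rq : 0 < r - q by rewrite subr_gt0.
pose X := 4 * (c1 * (c2 * d `^ r)).
have X0 : 0 <= X by rewrite !mulr_ge0 ?powR_ge0.
pose K := 2 + X `^ (r - q)^-1; have K2 : 2 <= K by rewrite lerDl powR_ge0.
have K0 : 0 < K by exact: lt_le_trans K2.
have Kq : 0 < K `^ q by exact: powR_gt0.
have XK : X <= K `^ (r - q).
  rewrite -[leLHS](powR_invK rq X0); apply: ler_powRl; rewrite ?powR_ge0 ?(ltW rq) //.
  by rewrite lerDr.
have Kr : K `^ r = K `^ q * K `^ (r - q).
  by rewrite -powRD ?subrKC // (gt_eqF K0) implybT.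
pose y := (4 * (K `^ q * c1 + 1))^-1.
have y0 : 0 < y by rewrite invr_gt0 mulr_gt0 // ltr_wpDl // mulr_ge0 // ltW.
exists K, (K * y `^ p^-1); split => //; first by rewrite mulr_gt0 // powR_gt0.
rewrite mulrAC mulfV ?gt_eqF // mul1r powR_invK ?(ltW y0) //.
have h1 : K `^ q * (c1 * y) <= 4^-1.
  rewrite mulrA /y ler_pdivrMr; last by rewrite mulr_gt0 // ltr_wpDl // mulr_ge0 // ltW.
  lra.
have h2 : K `^ q * (c1 * (c2 * (d / K) `^ r)) <= 4^-1.
  rewrite powRM ?invr_ge0 ?(ltW K0) // powRVl ?(ltW K0) //.
  rewrite (_ : _ * _ = X / 4 * (K `^ q / K `^ r)); last by rewrite /X; lra.
  rewrite Kr invfM mulVKf ?gt_eqF // ler_pdivrMr; last exact: powR_gt0.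
  by move: XK; lra.
rewrite mulrDr mulrDr; apply: (le_trans (lerD h1 h2)); lra.
Qed.

Section self_improvement.
Context (R : realType) (n : nat) (p q : R) (q0 : \bar R).
Context (B : cube R n -> (Rn R n -> R) -> (Rn R n -> R)) (alpha : nat -> R) (Sm : R).
Context (p1 : 1 <= p) (pq : p < q) (qq0 : (q%:E < q0)%E)
  (hlin : linear_on_Lploc p B) (hc : cond_c p q0 B alpha)
  (hAA : forall (S Q : cube R n), cset S `<=` cset Q ->
     forall f : Rn R n -> R, Lploc p f ->
     {ae leb R n, forall x, cset (dil 1 S) x ->
        Aop B S (Aop B Q f) x = Aop B Q f x})
  (hSm : forall m, \sum_(2 <= k < m) two_pow n p k * alpha k <= Sm)
  (Ca : R) (hCa : 1 <= Ca).

Let r := finexp q q0.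
Let p0 : 0 < p. Proof. exact: lt_le_trans p1. Qed.
Let q_gt0 : 0 < q. Proof. exact: lt_trans pq. Qed.
Let qr : q < r. Proof. exact: finexp_gt. Qed.
Let Sm0 : 0 <= Sm. Proof. by have := hSm 0; rewrite big_geq. Qed.
Let G := two_pow n p 1.
Let G1 : 1 <= G. Proof. exact: two_pow_ge1. Qed.
Let d := G * Sm + 2.
Let d0 : 0 <= d. Proof. by rewrite addr_ge0 // mulr_ge0 // (le_trans _ G1). Qed.

Definition gl_factor (K e : R) : R :=
  8 ^+ n * (2 * 3 `^ p) * ((e / K) `^ p + 2 * 12^-1 `^ (p - r) * (d / K) `^ r).

Section fixed_cube.
Context (f : Rn R n -> R) (a : cube R n -> R) (Lf : Lploc p f)
  (a0 : forall Q, 0 <= a Q)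
  (hB : forall (k : nat) (Q : cube R n),
     (avgp p (dil k Q) (B Q f) <= (a (dil k Q))%:E)%E)
  (hD : Dq_with q a Ca) (Q : cube R n) (A : R) (aA : a (dil 1 Q) <= A)
  (hA : forall m, \sum_(2 <= k < m) alpha k * two_pow n p k * a (dil k Q) <= A).

Let g := B Q f.
Let A0 : 0 <= A. Proof. exact: le_trans (a0 _) aA. Qed.
Let mB S h : Lploc p h -> measurable_fun setT (B S h).
Proof. by have [] := hlin S; auto. Qed.
Let mg : measurable_fun setT g. Proof. exact: mB. Qed.

Lemma Lploc_BQ : Lploc p g.
Proof.
apply: (@Lploc_dil _ _ _ Q) => // k.
by apply: le_lt_trans (proj1 (avgp_le _ _ p0 (a0 _)) (hB k Q)) _; rewrite ltry.
Qed.

Lemma local_part M t S : A <= t -> 0 < t -> S \in sel (crit p t g) M Q ->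
  (lpint r (dil 1 S) (Aop B S (restr (cset (dil 2 S)) g)) <=
     ((d * t) `^ r * vol (dil 1 S))%:E)%E /\
  (lpint r (dil 1 S) (Aop B S (restr (~` cset (dil 2 S)) g)) <=
     ((d * t) `^ r * vol (dil 1 S))%:E)%E.
Proof.
move=> At t0 SM; have [al0 [_ [hc1 hc2]]] := hc.
have [N [sQ anc]] := sel_ancestor SM.
have Lg := Lploc_BQ; have mS := measurable_cset (dil 2 S).
have hsum := sum_avgp_dil p0 (ltW t0) mg (fun k => a0 (dil k Q))
  (fun k => hB k Q) (sel_subc SM) sQ anc al0 hSm hA At.
have [h2 h3] := @nneseries_shift_le _
  (fun k => (alpha k)%:E * avgp p (dil k S) g)%E _
  (fun k k2 => mule_ge0 (al0 k k2 : (0 <= (alpha k)%:E)%E) (poweR_ge0 _ _)) hsum.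
have c0 : 0 <= (G * Sm + 1) * t.
  by rewrite mulr_ge0 ?(ltW t0) // addr_ge0 // mulr_ge0 // (le_trans _ G1).
have cd : (G * Sm + 1) * t < d * t by rewrite ltr_pM2r // ltrD2l ltr1n.
have mA (E : set (Rn R n)) : measurable E -> measurable_fun setT (Aop B S (restr E g)).
  move=> mE; apply: measurable_funB; first exact: measurable_restr.
  by apply: mB; apply: Lploc_restr => //; exact: ltW.
split; apply: (avgq_le q_gt0 qq0 _ c0 cd).
- exact: mA.
- exact: le_trans (hc1 S g Lg) h2.
- by apply: mA; exact: measurableC.
- exact: le_trans (hc2 S g 1%N _ Lg) h3.
Qed.

Lemma good_cube M t K e S L : A <= t -> 0 < t -> 2 <= K -> 0 < e ->
  S \in sel (crit p t g) M Q -> a (dil 1 S) <= e * t ->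
  (forall P, P \in L -> crit p (K * t) g P /\ subc P S) ->
  (leb R n (cunion L) <= (gl_factor K e * vol S)%:E)%E.
Proof.
move=> At t0 K2 e0 SM aS hL; have [h2 h3] := local_part At t0 SM.
have K0 : 0 < K by exact: lt_le_trans K2.
have SQ := sel_subc SM.
have hdec := decomposition p0 hlin Lf Lploc_BQ (measurable_cset (dil 2 S))
  (hAA (subc_cset SQ) Lf).
have eqK (c : R) : c * t = c / K * (K * t) by rewrite mulrA divfK // gt_eqF.
have mr (E : set (Rn R n)) : measurable E -> measurable_fun setT (Aop B S (restr E g)).
  move=> mE; apply: measurable_funB; first exact: measurable_restr.
  exact: mB (Lploc_restr (ltW p0) mE Lploc_BQ).
rewrite /gl_factor.
apply: (@good_lambda_cube _ _ p r S (K * t) (e / K) (d / K) g _ _ _ L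
  p1 _ _ _ _ mg _ _ _ hdec _ _ _ hL).
- by rewrite ltW // (lt_trans pq).
- by rewrite mulr_gt0.
- by rewrite divr_ge0 // ltW.
- by rewrite divr_ge0 // ltW.
- exact: mB.
- by apply: mr; exact: measurable_cset.
- by apply: mr; apply: measurableC; exact: measurable_cset.
- rewrite -eqK; apply: (le_trans (proj1 (avgp_le _ _ p0 (a0 _)) (hB 1 S))).
  rewrite lee_fin ler_wpM2r ?(ltW (vol_gt0 _)) //; apply: ler_powRl => //; exact: ltW.
- rewrite -eqK; exact: h2.
- rewrite -eqK; exact: h3.
Qed.

Lemma bad_cubes t e (L : seq (cube R n)) : A <= t -> 0 < t -> 0 < e ->
  (forall S, S \in L -> subc S Q /\ e * t <= a (dil 1 S)) ->
  (leb R n (cunion L) <= (8 ^+ n * (Ca / e * (A / t)) `^ q * vol Q)%:E)%E.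
Proof.
move=> At t0 e0 hL; have et0 : 0 < e * t by rewrite mulr_gt0.
have etq : 0 < (e * t) `^ q by exact: powR_gt0.
pose w P := a (dil 1 P) `^ q * vol (dil 1 P).
have w0 P : 0 <= w P by rewrite mulr_ge0 ?powR_ge0 // ltW // vol_gt0.
have [||L' [L'L dL' le]] := @vitali_measure R n L
  (fun P => (((e * t) `^ q)^-1)%:E * (w P)%:E)%E.
- by move=> P; rewrite -EFinM lee_fin mulr_ge0 // invr_ge0 ltW.
- move=> P /hL[_ aP]; rewrite lee_pdivlMl // -EFinM lee_fin.
  by rewrite ler_wpM2r ?(ltW (vol_gt0 _)) //; apply: ler_powRl; rewrite // ltW.
apply: (le_trans le); rewrite -ge0_sume_distrr; last by move=> P _; rewrite lee_fin.
have hDq := Dq_disj hD dL' (fun P PL => proj1 (hL P (L'L P PL))).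
apply: (@le_trans _ _ ((4 ^+ n)%:E * ((((e * t) `^ q)^-1)%:E *
   ((Ca * a (dil 1 Q)) `^ q * vol (dil 1 Q))%:E))%E).
  apply: lee_wpmul2l; first by rewrite lee_fin exprn_ge0.
  by apply: lee_wpmul2l; first by rewrite lee_fin invr_ge0 ltW.
have Ca0 : 0 <= Ca by exact: le_trans hCa.
rewrite -!EFinM lee_fin vol_dil mul1n.
have h8 : 8 ^+ n = 4 ^+ n * 2 ^+ n :> R by rewrite -exprMn; congr (_ ^+ n); lra.
have -> : Ca / e * (A / t) = (Ca * A) / (e * t).
  by field; rewrite !gt_eqF.
rewrite h8 [in leRHS]powRM ?mulr_ge0 ?invr_ge0 ?(ltW et0) //.
rewrite powRVl ?(ltW et0) //.
have hca : (Ca * a (dil 1 Q)) `^ q <= (Ca * A) `^ q.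
  by apply: ler_powRl; rewrite ?(ltW q_gt0) ?mulr_ge0 // ler_wpM2l.
set X := (Ca * A) `^ q in hca *; set Y := (Ca * _) `^ q in hca *.
rewrite (_ : _ * _ = 4 ^+ n * 2 ^+ n * (((e * t) `^ q)^-1 * vol Q) * Y); last by ring.
rewrite [leRHS](_ : _ = 4 ^+ n * 2 ^+ n * (((e * t) `^ q)^-1 * vol Q) * X); last by ring.
apply: ler_wpM2l => //; apply: mulr_ge0; first by rewrite mulr_ge0 ?exprn_ge0.
by rewrite mulr_ge0 ?invr_ge0 ?ltW // vol_gt0.
Qed.

Lemma gl_factor_ge0 K e : 0 <= gl_factor K e.
Proof.
rewrite /gl_factor; apply: mulr_ge0.
  by rewrite mulr_ge0 ?exprn_ge0 // mulr_ge0 ?powR_ge0.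
by rewrite addr_ge0 ?powR_ge0 // !mulr_ge0 ?powR_ge0.
Qed.

Lemma good_lambda_step M t K e : A <= t -> 0 < t -> 2 <= K -> 0 < e ->
  (leb R n (cunion (sel (crit p (K * t) g) M Q)) <=
   (gl_factor K e)%:E * leb R n (cunion (sel (crit p t g) M Q)) +
   (8 ^+ n * (Ca / e * (A / t)) `^ q * vol Q)%:E)%E.
Proof.
move=> At t0 K2 e0; have K0 : 0 < K by exact: lt_le_trans K2.
set L1 := sel (crit p t g) M Q; set L2 := sel _ M Q.
have crit_mono T : crit p (K * t) g T -> crit p t g T.
  move=> /asboolP h; apply/asboolP; apply: le_lt_trans h; rewrite lee_fin.
  rewrite ler_wpM2r ?(ltW (vol_gt0 _)) //; apply: ler_powRl; rewrite ?ltW //.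
  by rewrite -[ltLHS]mul1r ltr_pM2r // (lt_le_trans _ K2) // ltr1n.
pose bad := [seq S <- L1 | e * t <= a (dil 1 S)].
pose good := [seq S <- L1 | ~~ (e * t <= a (dil 1 S))].
pose F S := cunion [seq P <- L2 | `[< subc P S >]].
have cover : cunion L2 `<=` cunion bad `|` \bigcup_(S in [set` good]) F S.
  move=> x [P PL2 Px]; have [S SL1 PS] := sel_sub crit_mono PL2.
  have [Sb|Sg] := boolP (e * t <= a (dil 1 S)).
    by left; exists S; [rewrite /= mem_filter Sb|exact: subc_cset PS _ Px].
  right; exists S; first by rewrite /= mem_filter Sg.
  by exists P => //=; rewrite mem_filter PL2 andbT; apply/asboolP.
have mF S : measurable (F S) by exact: measurable_cunion.
have mU : measurable (\bigcup_(S in [set` good]) F S).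
  by apply: fin_bigcup_measurable => //; exact: finite_seq.
apply: (@le_trans _ _ (leb R n (cunion bad `|` \bigcup_(S in [set` good]) F S))).
  apply: le_measure; rewrite ?inE //; first exact: measurable_cunion.
  by apply: measurableU => //; exact: measurable_cunion.
apply: (le_trans (measureU2 _ (measurable_cunion _) mU)).
rewrite addeC; apply: leeD; last first.
  apply: bad_cubes => // S; rewrite mem_filter => /andP[-> SL1]; split=> //.
  exact: sel_subc SL1.
apply: (@le_trans _ _ (\sum_(S <- good) (gl_factor K e * vol S)%:E)%E).
  apply: (le_measure_list (F := F)) => // S; rewrite mem_filter -ltNge => /andP[aS SL1].
  apply: (good_cube At t0 K2 e0 SL1 (ltW aS)) => P; rewrite mem_filter.
  by move=> /andP[/asboolP PS PL2]; split=> //; exact: sel_crit PL2.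
rewrite -sum_sel ge0_sume_distrr; last by move=> S _; rewrite lee_fin ltW // vol_gt0.
rewrite big_filter -/L1 big_mkcond; apply: lee_sum => S _.
rewrite -EFinM; case: ifPn => // _; rewrite lee_fin mulr_ge0 ?gl_factor_ge0 //.
by rewrite ltW // vol_gt0.
Qed.

Definition gl_const (K e : R) : R :=
  1 + 2 * (8 ^+ n * (Ca / e) `^ q) * K `^ q.

Lemma gl_const_ge1 K e : 1 <= gl_const K e.
Proof.
by rewrite lerDl; apply: mulr_ge0; rewrite ?powR_ge0 //; apply: mulr_ge0 => //;
  rewrite mulr_ge0 ?powR_ge0 ?exprn_ge0.
Qed.

Lemma good_lambda_iter M m t0 K e : A <= t0 -> 0 < t0 -> 2 <= K -> 0 < e ->
  K `^ q * gl_factor K e <= 2^-1 ->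
  (leb R n (cunion (sel (crit p (K ^+ m * t0) g) M Q)) <=
    (gl_const K e * (K `^ q) ^- m * vol Q)%:E)%E.
Proof.
move=> At0 t00 K2 e0 hK; have K0 : 0 < K by exact: lt_le_trans K2.
have K1 : 1 <= K by apply: le_trans K2; rewrite ler1n.
have Kq : 0 < K `^ q by exact: powR_gt0.
have v0 := vol_gt0 Q; have E1 := gl_const_ge1 K e.
elim: m => [|m IH].
  rewrite !expr0 invr1 mul1r mulr1.
  apply: (@le_trans _ _ (vol Q)%:E); last by rewrite lee_fin ler_peMl // ltW.
  rewrite -leb_cset; apply: le_measure; rewrite ?inE.
  - exact: measurable_cunion.
  - exact: measurable_cset.
  - by apply: cunion_sub => S; exact: sel_subc.
have Km1 : 1 <= K ^+ m by exact: exprn_ege1.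
have Km : 0 < K ^+ m by exact: lt_le_trans Km1.
have At : A <= K ^+ m * t0 by apply: (le_trans At0); rewrite ler_peMl // ltW.
have Kt0 : 0 < K ^+ m * t0 by rewrite mulr_gt0.
have -> : K ^+ m.+1 * t0 = K * (K ^+ m * t0) by rewrite exprS mulrA.
apply: (le_trans (good_lambda_step M At Kt0 K2 e0)).
apply: (@le_trans _ _ ((gl_factor K e)%:E *
    (gl_const K e * (K `^ q) ^- m * vol Q)%:E +
    (8 ^+ n * ((Ca / e) `^ q * (K `^ q) ^- m) * vol Q)%:E)%E).
  apply: leeD; first by apply: lee_wpmul2l; rewrite ?lee_fin ?gl_factor_ge0.
  have Ce : 0 <= Ca / e by rewrite divr_ge0 ?(ltW e0) // (le_trans _ hCa).
  have AK : 0 <= A / (K ^+ m * t0) by rewrite divr_ge0 // ltW.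
  rewrite lee_fin ler_wpM2r ?(ltW v0) // ler_wpM2l ?exprn_ge0 // powRM //.
  rewrite ler_wpM2l ?powR_ge0 //.
  apply: (@le_trans _ _ ((K ^+ m)^-1 `^ q)).
    apply: ler_powRl; rewrite ?(ltW q_gt0) //.
    by rewrite invfM mulrCA ler_piMr ?invr_ge0 ?(ltW Km) // ler_pdivrMr ?mul1r.
  by rewrite powRVl ?powRXl ?(ltW K0) ?(ltW Km).
rewrite -EFinM -EFinD lee_fin.
have Kqm : 0 < (K `^ q) ^- m by rewrite invr_gt0 exprn_gt0.
have -> : (K `^ q) ^- m.+1 = (K `^ q)^-1 * (K `^ q) ^- m.
  by rewrite exprS invfM.
set X := (K `^ q) ^- m in Kqm *; set D := 8 ^+ n * (Ca / e) `^ q.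
have D0 : 0 <= D by rewrite mulr_ge0 ?powR_ge0 ?exprn_ge0.
have Xv : 0 <= X * vol Q by rewrite mulr_ge0 ?ltW.
have key : gl_factor K e * gl_const K e + D <= gl_const K e / K `^ q.
  rewrite ler_pdivlMr // mulrDl.
  have E0 : 0 <= gl_const K e by exact: le_trans E1.
  have E2 : 2 * (D * K `^ q) <= gl_const K e by rewrite /gl_const -/D; lra.
  by have := ler_wpM2r E0 hK; move: E2; lra.
have := ler_wpM2r Xv key; rewrite /D; lra.
Qed.

Lemma weak_level (t t0 K e : R) : A <= t0 -> 0 < t0 -> 2 <= K -> 0 < e ->
  K `^ q * gl_factor K e <= 2^-1 -> 0 < t ->
  (leb R n (cset Q `&` [set x | (t < `|g x|)%R]) <=
    (gl_const K e * (K * G * t0 / t) `^ q * vol Q)%:E)%E.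
Proof.
move=> At0 t00 K2 e0 hK t_gt0; have K0 : 0 < K by exact: lt_le_trans K2.
have v0 := vol_gt0 Q; have E1 := gl_const_ge1 K e.
have E0 : 0 <= gl_const K e by exact: le_trans E1.
have G0 : 0 < G by exact: lt_le_trans G1.
have mQ := measurable_cset Q.
have mgt (s : R) : measurable [set x | s < `|g x|].
  rewrite (_ : [set x | _] = setT `&` (fun x => `|g x|) @^-1` `]s, +oo[).
    apply: (measurableT_comp _ mg) => //; exact: normr_measurable.
  by rewrite setTI; apply/seteqP; split=> x /=; rewrite in_itv /= andbT.
have KG1 : 1 <= K * G by rewrite mulr_ege1 // (le_trans _ K2) // ler1n.
have [tG|Gt] := ltP t (G * t0).
  apply: (@le_trans _ _ (vol Q)%:E).
    by rewrite -leb_cset; apply: le_measure; rewrite ?inE //; exact: measurableI.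
  rewrite lee_fin ler_peMl ?(ltW v0) // mulr_ege1 //.
  apply: (@le_trans _ _ (1 `^ q)); first by rewrite powR1.
  apply: ler_powRl; rewrite ?(ltW q_gt0) //.
  rewrite ler_pdivlMr // mul1r -mulrA; apply: (le_trans (ltW tG)).
  by rewrite ler_peMl ?mulr_ge0 ?ltW // (lt_le_trans _ K2) // ltr1n.
have ex_m : exists m, t < G * t0 * K ^+ m.
  pose N := (Num.truncn (t / (G * t0))).+1; exists N.
  rewrite mulrC -ltr_pdivrMr ?mulr_gt0 //; apply: (@lt_le_trans _ _ N%:R).
    by rewrite truncnS_gt // divr_ge0 ?mulr_ge0 ?ltW.
  apply: (@le_trans _ _ (2 ^+ N)); first by rewrite -natrX ler_nat ltnW // ltn_expl.
  by apply: lerXn2r; rewrite ?nnegrE ?(ltW K0).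
have [m tm mt] : exists2 m, G * t0 * K ^+ m <= t & t < G * t0 * K ^+ m.+1.
  case: (ex_minnP ex_m) => -[|m] tm mmin.
    by move: tm; rewrite expr0 mulr1 ltNge Gt.
  exists m => //; rewrite leNgt; apply/negP => /mmin.
  by rewrite ltnn.
set s := K ^+ m * t0; have s0 : 0 < s by rewrite mulr_gt0 // exprn_gt0.
have Gs : G * s <= t by move: tm; rewrite /s; lra.
pose h x := `|g x| `^ p; pose l := (G * s) `^ p.
have mh : measurable_fun setT h.
  by apply/measurable_EFinP; exact: measurable_normpow.
have h0 x : 0 <= h x by exact: powR_ge0.
have null := @dyadic_differentiation R n Q (crit p s g) h l mh h0 (powR_ge0 _ _).
have {}null := null _; set U := \bigcup_M cunion (sel (crit p s g) M Q) in null.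
have mU : measurable U by apply: bigcup_measurable => M _; exact: measurable_cunion.
have mhl : measurable [set x | l < h x].
  rewrite (_ : [set x | _] = setT `&` h @^-1` `]l, +oo[).
    by apply: mh => //; exact: measurable_itv.
  by rewrite setTI; apply/seteqP; split=> x /=; rewrite in_itv /= andbT.
set W := (cset Q `&` [set x | l < h x]) `\` U in null.
have mW : measurable W by apply: measurableD => //; exact: measurableI.
have W0 : leb R n W = 0%E.
  apply: null => S cS; apply: (@le_trans _ _ (lpint p (dil 1 S) g)).
    exact: (lpint_subset p mg (subc_cset (subc_dil_self 1 S))).
  have : (lpint p (dil 1 S) g <= (s `^ p * vol (dil 1 S))%:E)%E.
    by rewrite leNgt; apply: contra cS => ?; apply/asboolP.
  move=> /le_trans; apply; rewrite lee_fin /l powRM ?(ltW G0) ?(ltW s0) //.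
  by rewrite two_powK // vol_dil; lra.
have sub : cset Q `&` [set x | t < `|g x|] `<=` W `|` U.
  move=> x [Qx /= tg]; have [Ux|Ux] := pselect (U x); first by right.
  left; split=> //; split=> //=; apply: gt0_ltr_powR => //; rewrite ?nnegrE //.
    by rewrite mulr_ge0 ?ltW.
  exact: le_lt_trans tg.
apply: (@le_trans _ _ (leb R n (W `|` U))).
  by apply: le_measure; rewrite ?inE //; [exact: measurableI|exact: measurableU].
apply: (le_trans (measureU2 _ mW mU)); rewrite [X in (X + _)%E]W0 add0e.
have hM M := good_lambda_iter M m At0 t00 K2 e0 hK.
apply: (@le_trans _ _ (gl_const K e * (K `^ q) ^- m * vol Q)%:E).
  have cU : leb R n (cunion (sel (crit p s g) M Q)) @[M --> \oo] --> leb R n U.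
    apply: nondecreasing_cvg_mu => //; first by move=> M; exact: measurable_cunion.
    apply/nondecreasing_seqP => M; apply/subsetPset; exact: sel_mono.
  have : (limn (fun M => leb R n (cunion (sel (crit p s g) M Q))) <=
      (gl_const K e * (K `^ q) ^- m * vol Q)%:E)%E.
    apply: lime_le; first by apply/cvg_ex; eexists; exact: cU.
    by apply: nearW => M; exact: hM.
  by rewrite (cvg_lim _ cU).
rewrite lee_fin ler_wpM2r ?(ltW v0) // ler_wpM2l //.
have Km : 0 < K ^+ m by rewrite exprn_gt0.
have -> : (K `^ q) ^- m = ((K ^+ m)^-1) `^ q.
  by rewrite powRVl ?powRXl ?(ltW K0) ?(ltW Km).
apply: ler_powRl; rewrite ?(ltW q_gt0) ?invr_ge0 ?(ltW Km) //.
rewrite ler_pdivlMr // mulrC ler_pdivrMr //.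
by apply: ltW; move: mt; rewrite exprS; lra.
Qed.

Lemma weaknorm_le t0 K e : A <= t0 -> 0 < t0 -> 2 <= K -> 0 < e ->
  K `^ q * gl_factor K e <= 2^-1 ->
  (weaknorm q Q g <= (gl_const K e `^ q^-1 * (K * G) * t0)%:E)%E.
Proof.
move=> At0 t00 K2 e0 hK; have K0 : 0 < K by exact: lt_le_trans K2.
have G0 : 0 < G by exact: lt_le_trans G1.
have E0 : 0 <= gl_const K e by apply: le_trans (gl_const_ge1 K e).
apply: ub_ereal_sup => _ [t t_gt0 <-].
have v0 := vol_gt0 Q.
have KGt : 0 <= K * G * t0 / t by rewrite divr_ge0 ?ltW // !mulr_gt0.
apply: (@le_trans _ _ (t%:E * (gl_const K e * (K * G * t0 / t) `^ q)%:E `^ q^-1)%E).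
  apply: lee_wpmul2l; first by rewrite lee_fin ltW.
  have q10 : 0 <= q^-1 by rewrite invr_ge0 ltW.
  apply: gt0_ler_poweR => //; rewrite ?in_itv /= ?leey ?andbT.
  - by rewrite mule_ge0 // lee_fin invr_ge0 ltW.
  - by rewrite lee_fin mulr_ge0 ?powR_ge0.
  - rewrite lee_pdivrMl // -EFinM.
    apply: (le_trans (weak_level At0 t00 K2 e0 hK t_gt0)).
    by rewrite lee_fin; lra.
rewrite poweR_EFin -EFinM lee_fin powRM ?powR_ge0 // powRK //.
rewrite le_eqVlt; apply/orP; left; apply/eqP; field.
by rewrite gt_eqF.
Qed.

End fixed_cube.
End self_improvement.

Theorem mainTheorem4 (R : realType) (n : nat) (hn : (1 <= n)%N)
  (p0 q : R) (q0 : \bar R)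
  (hp0 : 1 <= p0) (hp0q : p0 < q) (hqq0 : (q%:E < q0)%E)
  (B : cube R n -> (Rn R n -> R) -> (Rn R n -> R)) (alpha : nat -> R)
  (hlin : linear_on_Lploc p0 B)
  (hb : cond_b p0 B)
  (hc : cond_c p0 q0 B alpha)
  (hAA : forall (Rc Q : cube R n), cset Rc `<=` cset Q ->
     forall f : Rn R n -> R, Lploc p0 f ->
     {ae leb R n, forall x, cset (dil 1 Rc) x ->
        Aop B Rc (Aop B Q f) x = Aop B Q f x})
  (Ca : R) (hCa : 1 <= Ca) :
  exists C : R,
    forall (f : Rn R n -> R) (a : cube R n -> R),
      Lploc p0 f ->
      (forall Q, 0 <= a Q) ->
      (forall (k : nat) (Q : cube R n),
         (avgp p0 (dil k Q) (B Q f) <= (a (dil k Q))%:E)%E) ->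
      Dq_with q a Ca ->
      forall Q : cube R n,
        (weaknorm q Q (B Q f)
           <= C%:E * \sum_(1 <= k <oo) ((etak n p0 alpha k * a (dil k Q))%:E))%E.
Proof.
have p0_gt0 : 0 < p0 by exact: lt_le_trans hp0.
have [al0 [fin_sum _]] := hc.
have term0 k : (2 <= k)%N -> (0 <= (2 `^ (k%:R * n%:R / p0) * alpha k)%:E)%E.
  by move=> k2; rewrite lee_fin mulr_ge0 ?powR_ge0 // al0.
have [Sm hSm] : exists Sm, forall m, \sum_(2 <= k < m) two_pow n p0 k * alpha k <= Sm.
  set X := (\sum_(2 <= k <oo) _)%E in fin_sum.
  have X0 : (0 <= X)%E by apply: nneseries_ge0 => k k2 _; exact: term0.
  exists (fine X) => m; rewrite -lee_fin fineK ?ge0_fin_numE // -sumEFin.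
  by apply: nneseries_lim_ge => k k2 _; exact: term0.
pose r := finexp q q0; pose d := two_pow n p0 1 * Sm + 2.
have Sm0 : 0 <= Sm by have := hSm 0%N; rewrite big_geq.
have d0 : 0 <= d by rewrite addr_ge0 // mulr_ge0 ?powR_ge0.
have [|||K [e [K2 e0 hK]]] := @good_lambda_constants R p0 q r
  (8 ^+ n * (2 * 3 `^ p0)) (2 * 12^-1 `^ (p0 - r)) d p0_gt0 (finexp_gt hqq0).
- by rewrite mulr_ge0 ?exprn_ge0 // mulr_ge0 ?powR_ge0.
- by rewrite mulr_ge0 ?powR_ge0.
- exact: d0.
have {}hK : K `^ q * gl_factor n p0 q q0 Sm K e <= 2^-1 by exact: hK.
have K0 : 0 < K by exact: lt_le_trans K2.
pose C := gl_const n q Ca K e `^ q^-1 * (K * two_pow n p0 1).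
have C0 : 0 < C.
  apply: mulr_gt0; last by apply: mulr_gt0 => //; exact: powR_gt0.
  by apply: powR_gt0; apply: (lt_le_trans ltr01); exact: gl_const_ge1.
exists C => f a Lf a0 hB hD Q.
have eta0 k : (1 <= k)%N -> (0 <= (etak n p0 alpha k * a (dil k Q))%:E)%E.
  move=> k1; rewrite lee_fin mulr_ge0 // /etak; case: leqP => // k2.
  by rewrite mulr_ge0 ?powR_ge0 // al0.
set X := (\sum_(1 <= k <oo) _)%E.
have X0 : (0 <= X)%E by apply: nneseries_ge0 => k k1 _; exact: eta0.
have part m : (\sum_(1 <= k < m) (etak n p0 alpha k * a (dil k Q))%:E <= X)%E.
  by apply: nneseries_lim_ge => k k1 _; exact: eta0.
move: X0 part; case: X => [A||] // _ part; last by rewrite gt0_muley ?lte_fin // leey.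
have aA : a (dil 1 Q) <= A.
  by have := part 2%N; rewrite big_nat1 lee_fin /etak /= mul1r.
have hA m : \sum_(2 <= k < m) alpha k * two_pow n p0 k * a (dil k Q) <= A.
  have [m2|m2] := leqP m 2; first by rewrite big_geq // (le_trans (a0 (dil 1 Q))).
  have := part m; rewrite sumEFin lee_fin big_ltn; last exact: ltnW.
  apply: le_trans; rewrite -[leLHS]add0r lerD //.
    by rewrite -lee_fin eta0.
  rewrite [leLHS]big_nat_cond [leRHS]big_nat_cond; apply: ler_sum => k /andP[/andP[k2 _] _].
  by rewrite /etak leqNgt k2.
apply/lee_addgt0Pr => eps eps0.
have A0 : 0 <= A by exact: le_trans (a0 _) aA.
have AA : A <= A + eps / C by rewrite lerDl divr_ge0 // ltW.
have t00 : 0 < A + eps / C by rewrite ltr_wpDl // divr_gt0.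
apply: (le_trans (weaknorm_le hp0 hp0q hqq0 hlin hc hAA hSm hCa Lf a0 hB hD aA hA
  AA t00 K2 e0 hK)).
rewrite -/C -EFinM -EFinD lee_fin mulrDr mulrCA mulfV ?gt_eqF // mulr1 //.
Qed.
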